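(* Let $0<\alpha\le 1$, $1\le p\le 6$ an integer, $q\in\{1,2\}$, $\lambda\in\mathbb{C}$ with $\mathrm{Re}(\lambda)<0$, and let $\rho,\kappa$ be constants. Let $\omega(p,\alpha,1,z)=\sum_{n\ge 0}\omega^{(\alpha)}_n z^n$ be either the fractional backward difference generating function or the generalized Newton--Gregory generating function of order $p$ (both given in the context). Define $$\mathbb{S}=\mathbb{C}\setminus\left\{\xi\ \Big|\ \xi^{\alpha}=\frac{\omega(p,\alpha,1,z)}{(\lambda+\rho)-(\rho+\kappa)(1-z)^q}\ \text{ for some } |z|\le 1\right\}.$$ If the step size $\tau>0$ satisfies $\tau\in\mathbb{S}$, then the method $$\frac{1}{\tau^{\alpha}}\sum_{j=0}^{n}\omega^{(\alpha)}_{n-j}(U_j-U_0)=(\lambda+\rho)U_n-(\rho+\kappa)E^n_q(U),\qquad n\ge q,$$ for the model problem ${}_{C}D^{\alpha}_{0,t}u(t)=(\lambda+\rho)u(t)$ is stable.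
   Context: Caputo derivative: ${}_{C}D^{\alpha}_{0,t}u(t)=\frac{1}{\Gamma(1-\alpha)}\int_0^t (t-s)^{-\alpha}u'(s)\,ds$ for $0<\alpha<1$ (and $u'(t)$ for $\alpha=1$). $U_n$ approximates $u(t_n)$, $t_n=n\tau$. Generating functions. Fractional backward difference formula of order $p$: $\omega(p,\alpha,1,z)=\left(\sum_{k=1}^p\frac1k(1-z)^k\right)^{\alpha}$. Generalized Newton--Gregory formula of order $p$: $\omega(p,\alpha,1,z)=(1-z)^{\alpha}\sum_{k=1}^p g^{(\alpha)}_{k-1}(1-z)^{k-1}$, with $g^{(\alpha)}_0=1$, $g^{(\alpha)}_1=\frac{\alpha}{2}$, $g^{(\alpha)}_2=\frac{\alpha^2}{8}+\frac{5\alpha}{24}$, $g^{(\alpha)}_3=\frac{\alpha^3}{48}+\frac{5\alpha^2}{48}+\frac{\alpha}{8}$, $g^{(\alpha)}_4=\frac{\alpha^4}{384}+\frac{5\alpha^3}{192}+\frac{97\alpha^2}{1152}+\frac{251\alpha}{2880}$, $g^{(\alpha)}_5=\frac{\alpha^5}{3840}+\frac{5\alpha^4}{1152}+\frac{61\alpha^3}{2304}+\frac{401\alpha^2}{5760}+\frac{19\alpha}{288}$. The powers are the analytic branches on $|z|<1$ that are positive at $z=0$, extended continuously to $|z|\le 1$; $\omega^{(\alpha)}_n$ are the Taylor coefficients at $z=0$. Perturbation: $E^n_1(U)=U_n-U_{n-1}$ and $E^n_2(U)=U_n-2U_{n-1}+U_{n-2}$. The condition $\tau\in\mathbb{S}$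 is understood as: $\omega(p,\alpha,1,z)-\tau^{\alpha}\left[(\lambda+\rho)-(\rho+\kappa)(1-z)^q\right]\ne 0$ for all complex $z$ with $|z|\le 1$ (this fixes the meaning where the denominator vanishes). Stable means: for arbitrary starting values ($U_0$ if $q=1$; $U_0,U_1$ if $q=2$), the numerical solution generated by the recursion satisfies $U_n\to 0$ as $n\to\infty$. *)

(* Defs.v *)
From Stdlib Require Import Reals.
From Coquelicot Require Import Coquelicot.

Open Scope R_scope.
Open Scope C_scope.

Definition Cexp (z : C) : C :=
  (exp (Re z) * cos (Im z), exp (Re z) * sin (Im z))%R.

Definition ex_Cderive (f : C -> C) (z : C) : Prop :=
  ex_derive (K := C_AbsRing) (V := C_NormedModule) f z.

Definition continuous_on_closed_disk (f : C -> C) : Prop :=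
  forall z : C, Cmod z <= 1 ->
    filterlim f (within (fun y : C => Cmod y <= 1) (locally z)) (locally (f z)).

(** [power_branch f alpha g]: on the closed unit disk, [g] is the branch of
    [f ^ alpha] that is analytic on the open disk (i.e. [exp (alpha * L)] for
    an analytic logarithm [L] of [f]), positive at [0], and extended
    continuously to the boundary, where [f] is allowed to vanish.  These
    conditions determine [g] on the closed disk; nothing is said outside. *)
Definition power_branch (f : C -> C) (alpha : R) (g : C -> C) : Prop :=
  (exists L : C -> C, forall z : C, Cmod z < 1 ->
     ex_Cderive L z /\ Cexp (L z) = f z /\ g z = Cexp (RtoC alpha * L z)) /\
  (Im (g 0) = 0%R /\ (0 < Re (g 0))%R) /\
  continuous_on_closed_disk g.

Definition bdf_symbol (p : nat) (z : C) : C :=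
  sum_n_m (fun k : nat => / RtoC (INR k) * (1 - z) ^ k) 1 p.

Definition is_fbdf (p : nat) (alpha : R) (omega : C -> C) : Prop :=
  power_branch (bdf_symbol p) alpha omega.

(** Only the indices [0 .. 5] are meaningful (orders [p <= 6]). *)
Definition ng_coef (alpha : R) (k : nat) : R :=
  (match k with
   | 0 => 1
   | 1 => alpha / 2
   | 2 => alpha ^ 2 / 8 + 5 * alpha / 24
   | 3 => alpha ^ 3 / 48 + 5 * alpha ^ 2 / 48 + alpha / 8
   | 4 => alpha ^ 4 / 384 + 5 * alpha ^ 3 / 192 + 97 * alpha ^ 2 / 1152
          + 251 * alpha / 2880
   | 5 => alpha ^ 5 / 3840 + 5 * alpha ^ 4 / 1152 + 61 * alpha ^ 3 / 2304
          + 401 * alpha ^ 2 / 5760 + 19 * alpha / 288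
   | _ => 0
   end)%R.

Definition is_newton_gregory (p : nat) (alpha : R) (omega : C -> C) : Prop :=
  exists g : C -> C, power_branch (fun z => 1 - z) alpha g /\
    forall z : C, Cmod z <= 1 ->
      omega z = g z *
        sum_n_m (fun k : nat => RtoC (ng_coef alpha (k - 1)) * (1 - z) ^ (k - 1)) 1 p.

Definition taylor_coefs (omega : C -> C) (w : nat -> C) : Prop :=
  forall z : C, Cmod z < 1 ->
    is_pseries (K := C_AbsRing) (V := C_NormedModule) w z (omega z).

(** [tau] belongs to the set S; the condition is cleared of its denominator,
    which may vanish. *)
Definition step_in_S (alpha : R) (q : nat) (lambda rho kappa : C)
    (omega : C -> C) (tau : R) : Prop :=
  forall z : C, Cmod z <= 1 ->
    omega z - RtoC (Rpower tau alpha) *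
      ((lambda + rho) - (rho + kappa) * (1 - z) ^ q) <> 0.

(** Used for [q = 1] and [q = 2] only, at indices [n >= q], so that the
    subtractions on indices do not truncate. *)
Definition perturbation (q : nat) (U : nat -> C) (n : nat) : C :=
  match q with
  | 1 => U n - U (n - 1)%nat
  | _ => U n - 2 * U (n - 1)%nat + U (n - 2)%nat
  end.

Definition numerical_solution (alpha : R) (q : nat) (lambda rho kappa : C)
    (w : nat -> C) (tau : R) (U : nat -> C) : Prop :=
  forall n : nat, (q <= n)%nat ->
    / RtoC (Rpower tau alpha) *
      sum_n (fun j : nat => w (n - j)%nat * (U j - U 0%nat)) n
    = (lambda + rho) * U n - (rho + kappa) * perturbation q U n.

(** The starting values [U i], [i < q], are unconstrained. *)
Definition stable (alpha : R) (q : nat) (lambda rho kappa : C)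
    (w : nat -> C) (tau : R) : Prop :=
  forall U : nat -> C,
    numerical_solution alpha q lambda rho kappa w tau U ->
    filterlim U eventually (locally (RtoC 0)).

(* Main.v *)
Require Import Defs.
From Stdlib Require Import Reals Lra Lia Classical ClassicalEpsilon.
From Coquelicot Require Import Coquelicot.

(** Write G(z) = omega(z) - tau^alpha ((lambda+rho) - (rho+kappa)(1-z)^q).  The recursion says
    that the U_n are the Taylor coefficients at 0 of H = F / G, where
    F(z) = r0 + r1 z + U_0 omega(z) / (1-z).  Cauchy's theorem gives U_n as the n-th Fourier
    coefficient of H on every circle |z| = r < 1.  As G has no zero in the closed disk, H extends
    continuously to the closed disk minus 1, and |H| = O(|1-z|^(alpha-1)) near 1, which is
    integrable on the circle; so the U_n tend to 0 by the Riemann-Lebesgue argument (comparing H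
    with its rotation by pi/n), made uniform in the radius and applied at radius exp(-1/n). *)

Local Open Scope C_scope.

(** Nothing is known beforehand about the growth of the [U_n], so their generating series cannot be
    assumed to converge anywhere. The identity between [G], the [U_n] and [F] is therefore read in
    terms of asymptotic expansions at the origin ([jet]): division by [G] then needs only
    [G 0 <> 0], and Cauchy's coefficient formula holds for every function that is holomorphic on the
    punctured disk and has such an expansion. The singular term of [F] comes from subtracting [U_0]
    inside the convolution, which produces the partial sums of the weights; [r0] and [r1] take up
    the starting values. Since [H] may blow up at 1, it need not be uniformly continuous. The
    substitute is a modulus of continuity weighted by [|1-z|^(-g)] with [g = 1 - alpha/2]: the spare
    [alpha/2] makes [H] small against the weight near 1, and [g < 1] keeps the weight integrable.
    The radius [exp(-1/n)] tends to 1 while its power of exponent [-n] stays equal to [e]. Circles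
    are written as [exp(s + it)], which turns contour integrals into real integrals over
    [[-PI, PI]]. *)

(** * Elementary inequalities for the modulus *)

Lemma Cmod_sub_sym (a b : C) : Cmod (a - b) = Cmod (b - a).
Proof. replace (a - b) with (- (b - a)) by ring. apply Cmod_opp. Qed.

Lemma Cmod_sub_triangle (a b c : C) : (Cmod (a - c) <= Cmod (a - b) + Cmod (b - c))%R.
Proof. replace (a - c) with ((a - b) + (b - c)) by ring. apply Cmod_triangle. Qed.

Lemma Cmod_le_sub (a b : C) : (Cmod a <= Cmod b + Cmod (a - b))%R.
Proof. replace a with (b + (a - b)) at 1 by ring. apply Cmod_triangle. Qed.

Lemma im_le_Cmod (z : C) : (Rabs (Im z) <= Cmod z)%R.
Proof. eapply Rle_trans; [|apply Rmax_Cmod]. apply Rmax_r. Qed.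

Lemma Cmod_le_re_im (z : C) : (Cmod z <= Rabs (Re z) + Rabs (Im z))%R.
Proof.
  replace z with (RtoC (Re z) + Ci * RtoC (Im z)) at 1.
  2:{ destruct z as [x y]; apply injective_projections; simpl; ring. }
  eapply Rle_trans; [apply Cmod_triangle|].
  rewrite Cmod_mult, Cmod_Ci, !Cmod_R. lra.
Qed.

(** * Neighbourhoods and continuity *)

Definition near (z : C) (P : C -> Prop) : Prop :=
  exists d : R, (0 < d)%R /\ forall w : C, (Cmod (w - z) < d)%R -> P w.

Lemma near_and (z : C) (P Q : C -> Prop) :
  near z P -> near z Q -> near z (fun w => P w /\ Q w).
Proof.
  intros [d [Hd HP]] [e [He HQ]]. exists (Rmin d e). split.
  - now apply Rmin_glb_lt.
  - intros w Hw. split.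
    + apply HP. eapply Rlt_le_trans; [apply Hw | apply Rmin_l].
    + apply HQ. eapply Rlt_le_trans; [apply Hw | apply Rmin_r].
Qed.

Lemma near_imp (z : C) (P Q : C -> Prop) :
  (forall w, P w -> Q w) -> near z P -> near z Q.
Proof. intros H [d [Hd HP]]. exists d. auto. Qed.

Lemma near_all (z : C) (P : C -> Prop) : (forall w, P w) -> near z P.
Proof. intros H. exists 1%R. split; [lra | auto]. Qed.

Lemma near_self (z : C) (P : C -> Prop) : near z P -> P z.
Proof.
  intros [d [Hd H]]. apply H. replace (z - z) with (RtoC 0) by ring. now rewrite Cmod_0.
Qed.

Lemma near_Cmod_lt (z : C) (r : R) : (Cmod z < r)%R -> near z (fun w => (Cmod w < r)%R).
Proof.
  intros Hz. exists (r - Cmod z)%R. split; [lra|].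
  intros w Hw. pose proof (Cmod_le_sub w z). lra.
Qed.

(** The point [z] need not lie in [D]: for the open disk and a boundary point [z], the condition
    says that [f] tends to [f z] from inside. *)
Definition contw (D : C -> Prop) (f : C -> C) (z : C) : Prop :=
  forall e : R, (0 < e)%R -> near z (fun w => D w -> (Cmod (f w - f z) < e)%R).

Definition cont : (C -> C) -> C -> Prop := contw (fun _ => True).

Lemma cont_contw (D : C -> Prop) (f : C -> C) (z : C) : cont f z -> contw D f z.
Proof. intros H e He. eapply near_imp; [|apply (H e He)]. simpl; auto. Qed.

Lemma contw_ext (D : C -> Prop) (f g : C -> C) (z : C) :
  near z (fun w => D w -> f w = g w) -> D z -> contw D f z -> contw D g z.
Proof.
  intros H Dz Hf e He. pose proof (near_self _ _ H Dz) as Hz. simpl in Hz.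
  eapply near_imp; [|exact (near_and _ _ _ H (Hf e He))].
  intros w [H1 H2] Dw. rewrite <- (H1 Dw), <- Hz. auto.
Qed.

Lemma contw_const (D : C -> Prop) (c z : C) : contw D (fun _ => c) z.
Proof.
  intros e He. apply near_all. intros w _. replace (c - c) with (RtoC 0) by ring.
  now rewrite Cmod_0.
Qed.

Lemma contw_id (D : C -> Prop) (z : C) : contw D (fun w => w) z.
Proof. intros e He. exists e. auto. Qed.

Lemma contw_plus (D : C -> Prop) (f g : C -> C) (z : C) :
  contw D f z -> contw D g z -> contw D (fun w => f w + g w) z.
Proof.
  intros Hf Hg e He. assert (He2 : (0 < e / 2)%R) by lra.
  eapply near_imp; [|exact (near_and _ _ _ (Hf _ He2) (Hg _ He2))].
  intros w [H1 H2] Dw. specialize (H1 Dw). specialize (H2 Dw).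
  replace (f w + g w - (f z + g z)) with ((f w - f z) + (g w - g z)) by ring.
  pose proof (Cmod_triangle (f w - f z) (g w - g z)). lra.
Qed.

Lemma contw_mult (D : C -> Prop) (f g : C -> C) (z : C) :
  contw D f z -> contw D g z -> contw D (fun w => f w * g w) z.
Proof.
  intros Hf Hg e He.
  set (a := Cmod (f z)). set (b := Cmod (g z)).
  assert (Ha : (0 <= a)%R) by apply Cmod_ge_0. assert (Hb : (0 <= b)%R) by apply Cmod_ge_0.
  set (m := Rmin 1 (e / (a + b + 1))).
  assert (Hm1 : (m <= 1)%R) by apply Rmin_l.
  assert (Hm2 : (m * (a + b + 1) <= e)%R).
  { apply Rle_trans with (e / (a + b + 1) * (a + b + 1))%R.
    - apply Rmult_le_compat_r; [lra | apply Rmin_r].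
    - right. field. lra. }
  assert (Hm : (0 < m)%R).
  { apply Rmin_glb_lt; [lra|]. apply Rdiv_lt_0_compat; lra. }
  eapply near_imp; [|exact (near_and _ _ _ (Hf _ Hm) (Hg _ Hm))].
  intros w [H1 H2] Dw. specialize (H1 Dw). specialize (H2 Dw).
  replace (f w * g w - f z * g z)
    with ((f w - f z) * (g w - g z) + ((f w - f z) * g z + f z * (g w - g z))) by ring.
  pose proof (Cmod_triangle ((f w - f z) * (g w - g z))
                ((f w - f z) * g z + f z * (g w - g z))) as T1.
  pose proof (Cmod_triangle ((f w - f z) * g z) (f z * (g w - g z))) as T2.
  rewrite Cmod_mult in T1. rewrite (Cmod_mult (f w - f z)), (Cmod_mult (f z)) in T2.
  fold a b in T1, T2.
  pose proof (Cmod_ge_0 (f w - f z)). pose proof (Cmod_ge_0 (g w - g z)).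
  assert (Cmod (f w - f z) * Cmod (g w - g z) < m * 1)%R.
  { apply Rmult_le_0_lt_compat; lra. }
  assert (Cmod (f w - f z) * b <= m * b)%R by (apply Rmult_le_compat_r; lra).
  assert (a * Cmod (g w - g z) <= a * m)%R by (apply Rmult_le_compat_l; lra).
  lra.
Qed.

Lemma contw_lower_bound (D : C -> Prop) (f : C -> C) (z : C) :
  contw D f z -> f z <> 0 -> near z (fun w => D w -> (Cmod (f z) / 2 < Cmod (f w))%R).
Proof.
  intros Hf Hz. apply Cmod_gt_0 in Hz.
  assert (H2 : (0 < Cmod (f z) / 2)%R) by lra.
  eapply near_imp; [|exact (Hf _ H2)].
  intros w Hw Dw. specialize (Hw Dw). pose proof (Cmod_le_sub (f z) (f w)) as T.
  rewrite Cmod_sub_sym in T. lra.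
Qed.

Lemma contw_upper_bound (D : C -> Prop) (f : C -> C) (z : C) :
  contw D f z -> near z (fun w => D w -> (Cmod (f w) < Cmod (f z) + 1)%R).
Proof.
  intros Hf. eapply near_imp; [|exact (Hf 1%R Rlt_0_1)].
  intros w Hw Dw. specialize (Hw Dw). pose proof (Cmod_le_sub (f w) (f z)). lra.
Qed.

Lemma contw_inv (D : C -> Prop) (f : C -> C) (z : C) :
  contw D f z -> f z <> 0 -> contw D (fun w => / f w) z.
Proof.
  intros Hf Hz e He. pose proof (proj1 (Cmod_gt_0 _) Hz) as Hz'.
  pose proof (contw_lower_bound D f z Hf Hz) as HL.
  set (a := Cmod (f z)) in *.
  assert (He2 : (0 < e * (a * a / 2))%R).
  { apply Rmult_lt_0_compat; [lra|]. pose proof (Rmult_lt_0_compat _ _ Hz' Hz'). lra. }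
  eapply near_imp; [|exact (near_and _ _ _ (Hf _ He2) HL)].
  intros w [H1 H2] Dw. specialize (H1 Dw). specialize (H2 Dw).
  assert (Hw : f w <> 0) by (apply Cmod_gt_0; lra).
  replace (/ f w - / f z) with ((f z - f w) / (f w * f z)) by (field; auto).
  rewrite Cmod_div by (now apply Cmult_neq_0). rewrite Cmod_mult, Cmod_sub_sym. fold a.
  assert (0 < Cmod (f w) * a)%R by (apply Rmult_lt_0_compat; lra).
  apply Rmult_lt_reg_r with (Cmod (f w) * a)%R; [lra|].
  unfold Rdiv. rewrite Rmult_assoc, Rinv_l, Rmult_1_r by lra.
  eapply Rlt_trans; [exact H1|]. apply Rmult_lt_compat_l; [lra|].
  replace (a * a / 2)%R with (a / 2 * a)%R by field.
  apply Rmult_lt_compat_r; lra.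
Qed.

Lemma contw_opp (D : C -> Prop) (f : C -> C) (z : C) :
  contw D f z -> contw D (fun w => - f w) z.
Proof.
  intros Hf e He. eapply near_imp; [|exact (Hf e He)]. intros w H Dw. simpl.
  replace (- f w - - f z) with (- (f w - f z)) by ring. rewrite Cmod_opp. auto.
Qed.

Lemma contw_minus (D : C -> Prop) (f g : C -> C) (z : C) :
  contw D f z -> contw D g z -> contw D (fun w => f w - g w) z.
Proof. intros Hf Hg. apply contw_plus; [exact Hf | now apply contw_opp]. Qed.

Lemma contw_pow (D : C -> Prop) (f : C -> C) (z : C) (n : nat) :
  contw D f z -> contw D (fun w => f w ^ n) z.
Proof.
  intros Hf. induction n as [|n IH]; simpl; [apply contw_const | now apply contw_mult].
Qed.

Lemma cont_near (g : C -> C) (z : C) (P : C -> Prop) :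
  cont g z -> near (g z) P -> near z (fun w => P (g w)).
Proof.
  intros Hg [d [Hd H]]. eapply near_imp; [|exact (Hg d Hd)]. simpl. auto.
Qed.

Lemma cont_comp (f g : C -> C) (z : C) :
  cont f (g z) -> cont g z -> cont (fun w => f (g w)) z.
Proof.
  intros Hf Hg e He.
  exact (cont_near g z (fun y => True -> (Cmod (f y - f (g z)) < e)%R) Hg (Hf e He)).
Qed.

(** * Complex differentiability *)

(** Caratheodory's form of the derivative, with a slope function [q] continuous at [z]: the product,
    inverse and chain rules become algebra on slopes. *)
Definition cderiv (f : C -> C) (z l : C) : Prop :=
  exists q : C -> C, near z (fun w => f w = f z + (w - z) * q w) /\ cont q z /\ q z = l.

Lemma cderiv_cont (f : C -> C) (z l : C) : cderiv f z l -> cont f z.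
Proof.
  intros [q [H [Hq _]]].
  assert (K : cont (fun w => f z + (w - z) * q w) z).
  { apply contw_plus; [apply contw_const|]. apply contw_mult; [|exact Hq].
    apply contw_minus; [apply contw_id | apply contw_const]. }
  revert K. apply contw_ext; [|exact I]. eapply near_imp; [|exact H]. simpl. intros; congruence.
Qed.

Lemma cderiv_ext_near (f g : C -> C) (z l : C) :
  near z (fun w => f w = g w) -> cderiv f z l -> cderiv g z l.
Proof.
  intros H [q [Hf Hq]]. exists q. split; [|exact Hq].
  pose proof (near_self _ _ H) as Hz. simpl in Hz.
  eapply near_imp; [|exact (near_and _ _ _ H Hf)]. intros w [H1 H2]. congruence.
Qed.

Lemma cderiv_const (c z : C) : cderiv (fun _ => c) z 0.
Proof.
  exists (fun _ => RtoC 0). split; [|split; [apply contw_const | reflexivity]].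
  apply near_all. intros w. ring.
Qed.

Lemma cderiv_id (z : C) : cderiv (fun w => w) z 1.
Proof.
  exists (fun _ => RtoC 1). split; [|split; [apply contw_const | reflexivity]].
  apply near_all. intros w. ring.
Qed.

Lemma cderiv_plus (f g : C -> C) (z l m : C) :
  cderiv f z l -> cderiv g z m -> cderiv (fun w => f w + g w) z (l + m).
Proof.
  intros [q [Hf [Hq Eq]]] [s [Hg [Hs Es]]]. exists (fun w => q w + s w).
  split; [|split; [now apply contw_plus | now rewrite Eq, Es]].
  eapply near_imp; [|exact (near_and _ _ _ Hf Hg)].
  intros w [H1 H2]. simpl. rewrite H1, H2. ring.
Qed.

Lemma cderiv_mult (f g : C -> C) (z l m : C) :
  cderiv f z l -> cderiv g z m -> cderiv (fun w => f w * g w) z (l * g z + f z * m).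
Proof.
  intros Df Dg. pose proof (cderiv_cont _ _ _ Dg) as Cg.
  destruct Df as [q [Hf [Hq Eq]]]. destruct Dg as [s [Hg [Hs Es]]].
  exists (fun w => q w * g w + f z * s w).
  split; [|split; [|now rewrite Eq, Es]].
  - eapply near_imp; [|exact (near_and _ _ _ Hf Hg)].
    intros w [H1 H2]. simpl. rewrite H1, H2. ring.
  - apply contw_plus; apply contw_mult; trivial. apply contw_const.
Qed.

Lemma cderiv_inv (g : C -> C) (z m : C) :
  cderiv g z m -> g z <> 0 -> cderiv (fun w => / g w) z (- m * / (g z * g z)).
Proof.
  intros Dg Hz. pose proof (cderiv_cont _ _ _ Dg) as Cg.
  destruct Dg as [s [Hg [Hs Es]]].
  exists (fun w => - s w * / (g w * g z)).
  split; [|split; [|now rewrite Es]].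
  - eapply near_imp; [|exact (near_and _ _ _ Hg (contw_lower_bound _ _ _ Cg Hz))].
    intros w [H1 H2]. specialize (H2 I). apply Cmod_gt_0 in Hz as Hz'.
    assert (Hw : g w <> 0) by (apply Cmod_gt_0; lra).
    transitivity (/ g z + - ((w - z) * s w) * / (g w * g z)); [|ring].
    replace ((w - z) * s w) with (g w - g z) by (rewrite H1; ring). field. auto.
  - apply contw_mult; [now apply contw_opp|].
    apply contw_inv; [|now apply Cmult_neq_0].
    apply contw_mult; [exact Cg | apply contw_const].
Qed.

Lemma cderiv_comp (f g : C -> C) (z l m : C) :
  cderiv f (g z) l -> cderiv g z m -> cderiv (fun w => f (g w)) z (l * m).
Proof.
  intros Df Dg. pose proof (cderiv_cont _ _ _ Dg) as Cg.
  destruct Df as [q [Hf [Hq Eq]]]. destruct Dg as [s [Hg [Hs Es]]].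
  exists (fun w => q (g w) * s w).
  split; [|split; [|now rewrite Eq, Es]].
  - eapply near_imp; [|exact (near_and _ _ _ (cont_near g z _ Cg Hf) Hg)].
    intros w [H1 H2]. simpl in H1. rewrite H1, H2. ring.
  - apply contw_mult; [|exact Hs]. now apply (cont_comp q g).
Qed.

(** Two slope functions agree off [z], hence also in the limit at [z]; one small real displacement,
    lying in all four neighbourhoods, gives the contradiction. *)
Lemma cderiv_unique (f : C -> C) (z l m : C) : cderiv f z l -> cderiv f z m -> l = m.
Proof.
  intros [q [Hf [Hq Eq]]] [s [Hg [Hs Es]]]. subst l m.
  apply NNPP. intros N.
  assert (P : (0 < Cmod (q z - s z) / 2)%R).
  { apply Rdiv_lt_0_compat; [|lra]. apply Cmod_gt_0. intros E. apply N.
    replace (q z) with (q z - s z + s z) by ring. rewrite E. ring. }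
  destruct (near_and _ _ _ (near_and _ _ _ Hf Hg) (near_and _ _ _ (Hq _ P) (Hs _ P)))
    as [d [Hd H]].
  assert (Hw : Cmod (z + RtoC (d / 2) - z) = (d / 2)%R).
  { replace (z + RtoC (d / 2) - z) with (RtoC (d / 2)) by ring.
    rewrite Cmod_R. apply Rabs_pos_eq. lra. }
  destruct (H (z + RtoC (d / 2))) as [[H1 H2] [H3 H4]]; [rewrite Hw; lra|].
  set (w := z + RtoC (d / 2)) in *.
  assert (E : q w = s w).
  { assert (W : w - z <> 0) by (apply Cmod_gt_0; rewrite Hw; lra).
    replace (q w) with ((f z + (w - z) * q w - f z) / (w - z)) by (now field).
    rewrite <- H1, H2. now field. }
  specialize (H3 I). specialize (H4 I). rewrite <- E in H4. rewrite Cmod_sub_sym in H3.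
  pose proof (Cmod_sub_triangle (q z) (q w) (s z)). lra.
Qed.

Lemma Csub_neq_0 (w z : C) : w <> z -> w - z <> 0.
Proof.
  intros Hw E. apply Hw. replace w with (w - z + z) by ring. rewrite E. ring.
Qed.

Lemma cderiv_of_error (f : C -> C) (z l : C) :
  (forall e : R, (0 < e)%R ->
     near z (fun w => (Cmod (f w - f z - (w - z) * l) <= e * Cmod (w - z))%R)) ->
  cderiv f z l.
Proof.
  intros H.
  exists (fun w => if excluded_middle_informative (w = z) then l else (f w - f z) / (w - z)).
  split; [|split].
  - apply near_all. intros w. destruct (excluded_middle_informative (w = z)) as [-> | Hw].
    + ring.
    + field. now apply Csub_neq_0.
  - intros e He. assert (He2 : (0 < e / 2)%R) by lra.
    destruct (H _ He2) as [d [Hd Hdw]].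
    exists d. split; [exact Hd|]. intros w Hw _.
    destruct (excluded_middle_informative (z = z)) as [_|N]; [|now contradict N].
    destruct (excluded_middle_informative (w = z)) as [->|N].
    + replace (l - l) with (RtoC 0) by ring. now rewrite Cmod_0.
    + specialize (Hdw w Hw).
      pose proof (Csub_neq_0 _ _ N) as W. apply Cmod_gt_0 in W as W'.
      replace ((f w - f z) / (w - z) - l) with ((f w - f z - (w - z) * l) / (w - z))
        by (now field).
      rewrite Cmod_div by trivial.
      apply Rle_lt_trans with (e / 2)%R; [|lra].
      apply Rmult_le_reg_r with (Cmod (w - z)); [lra|].
      unfold Rdiv at 1. rewrite Rmult_assoc, Rinv_l, Rmult_1_r by lra. exact Hdw.
  - destruct (excluded_middle_informative (z = z)) as [_|N]; [reflexivity | now contradict N].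
Qed.

Lemma cderiv_of_ex_Cderive (f : C -> C) (z : C) : ex_Cderive f z -> exists l, cderiv f z l.
Proof.
  intros [l [_ H]]. exists l. apply cderiv_of_error. intros e He.
  destruct (H z (fun P HP => HP) (mkposreal _ He)) as [d Hd].
  exists d. split; [apply cond_pos|]. exact Hd.
Qed.

(** The derivative is required to be continuous because Cauchy's theorem will be obtained by
    differentiating under the integral sign. *)
Definition hol (D : C -> Prop) (f : C -> C) : Prop :=
  exists f' : C -> C, forall z, D z -> cderiv f z (f' z) /\ cont f' z.

Lemma hol_cont (D : C -> Prop) (f : C -> C) (z : C) : hol D f -> D z -> cont f z.
Proof. intros [f' H] Dz. exact (cderiv_cont _ _ _ (proj1 (H z Dz))). Qed.

Lemma hol_sub (D E : C -> Prop) (f : C -> C) : (forall z, E z -> D z) -> hol D f -> hol E f.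
Proof. intros H [f' Hf]. exists f'. auto. Qed.

Lemma hol_ext (D : C -> Prop) (f g : C -> C) :
  (forall z, D z -> near z D) -> (forall z, D z -> f z = g z) -> hol D f -> hol D g.
Proof.
  intros Op E [f' Hf]. exists f'. intros z Dz. destruct (Hf z Dz) as [H1 H2].
  split; [|exact H2]. apply cderiv_ext_near with f; [|exact H1].
  eapply near_imp; [|exact (Op z Dz)]. exact E.
Qed.

Lemma hol_const (D : C -> Prop) (c : C) : hol D (fun _ => c).
Proof.
  exists (fun _ => RtoC 0). intros z _. split; [apply cderiv_const | apply contw_const].
Qed.

Lemma hol_id (D : C -> Prop) : hol D (fun z => z).
Proof.
  exists (fun _ => RtoC 1). intros z _. split; [apply cderiv_id | apply contw_const].
Qed.

Lemma hol_plus (D : C -> Prop) (f g : C -> C) :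
  hol D f -> hol D g -> hol D (fun z => f z + g z).
Proof.
  intros [f' Hf] [g' Hg]. exists (fun z => f' z + g' z). intros z Dz.
  destruct (Hf z Dz), (Hg z Dz). split; [now apply cderiv_plus | now apply contw_plus].
Qed.

Lemma hol_mult (D : C -> Prop) (f g : C -> C) :
  hol D f -> hol D g -> hol D (fun z => f z * g z).
Proof.
  intros [f' Hf] [g' Hg]. exists (fun z => f' z * g z + f z * g' z). intros z Dz.
  destruct (Hf z Dz) as [Df Cf'], (Hg z Dz) as [Dg Cg'].
  pose proof (cderiv_cont _ _ _ Df). pose proof (cderiv_cont _ _ _ Dg).
  split; [now apply cderiv_mult|]. apply contw_plus; now apply contw_mult.
Qed.

Lemma hol_inv (D : C -> Prop) (f : C -> C) :
  hol D f -> (forall z, D z -> f z <> 0) -> hol D (fun z => / f z).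
Proof.
  intros [f' Hf] H. exists (fun z => - f' z * / (f z * f z)). intros z Dz.
  destruct (Hf z Dz) as [Df Cf']. pose proof (cderiv_cont _ _ _ Df). specialize (H z Dz).
  split; [now apply cderiv_inv|].
  apply contw_mult; [now apply contw_opp|].
  apply contw_inv; [now apply contw_mult | now apply Cmult_neq_0].
Qed.

Lemma hol_opp (D : C -> Prop) (f : C -> C) : hol D f -> hol D (fun z => - f z).
Proof.
  intros [f' Hf]. exists (fun z => 0 * f z + - (1) * f' z). intros z Dz.
  destruct (Hf z Dz) as [Df Cf']. split.
  - apply cderiv_ext_near with (fun w => - (1) * f w).
    + apply near_all. intros w. ring.
    + apply (cderiv_mult (fun _ => - (1)) f); [apply cderiv_const | exact Df].
  - apply contw_plus; apply contw_mult; trivial; try apply contw_const.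
    exact (cderiv_cont _ _ _ Df).
Qed.

Lemma hol_minus (D : C -> Prop) (f g : C -> C) :
  hol D f -> hol D g -> hol D (fun z => f z - g z).
Proof. intros Hf Hg. apply hol_plus; [exact Hf | now apply hol_opp]. Qed.

Lemma hol_pow (D : C -> Prop) (f : C -> C) (n : nat) : hol D f -> hol D (fun z => f z ^ n).
Proof. intros Hf. induction n; simpl; [apply hol_const | now apply hol_mult]. Qed.

Lemma hol_comp (D E : C -> Prop) (f g : C -> C) :
  hol E f -> hol D g -> (forall z, D z -> E (g z)) -> hol D (fun z => f (g z)).
Proof.
  intros [f' Hf] [g' Hg] H. exists (fun z => f' (g z) * g' z). intros z Dz.
  destruct (Hf _ (H z Dz)) as [Df Cf'], (Hg z Dz) as [Dg Cg'].
  split; [now apply cderiv_comp|]. apply contw_mult; [|exact Cg'].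
  apply (cont_comp f' g); [exact Cf' | exact (cderiv_cont _ _ _ Dg)].
Qed.

(** * The complex exponential *)

Lemma Re_minus (a b : C) : Re (a - b) = (Re a - Re b)%R.
Proof. reflexivity. Qed.

Lemma Cexp_plus (z w : C) : Cexp (z + w) = Cexp z * Cexp w.
Proof.
  unfold Cexp. rewrite re_plus, im_plus, exp_plus, cos_plus, sin_plus.
  apply injective_projections; simpl; ring.
Qed.

Lemma Cexp_0 : Cexp 0 = 1.
Proof. unfold Cexp; simpl. rewrite exp_0, cos_0, sin_0, Rmult_0_r, Rmult_1_l. reflexivity. Qed.

Lemma Cmod_Cexp (z : C) : Cmod (Cexp z) = exp (Re z).
Proof.
  unfold Cmod, Cexp; simpl fst; simpl snd.
  replace ((exp (Re z) * cos (Im z)) ^ 2 + (exp (Re z) * sin (Im z)) ^ 2)%R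
    with (exp (Re z) ^ 2)%R.
  - apply sqrt_pow2. left. apply exp_pos.
  - pose proof (sin2_cos2 (Im z)) as H. unfold Rsqr in H.
    transitivity (exp (Re z) ^ 2 * (sin (Im z) * sin (Im z) + cos (Im z) * cos (Im z)))%R.
    + rewrite H. ring.
    + ring.
Qed.

Lemma Cexp_neq_0 (z : C) : Cexp z <> 0.
Proof. apply Cmod_gt_0. rewrite Cmod_Cexp. apply exp_pos. Qed.

Lemma Cexp_pow (z : C) (n : nat) : Cexp z ^ n = Cexp (RtoC (INR n) * z).
Proof.
  induction n as [|n IH].
  - simpl. replace (0 * z) with (RtoC 0) by ring. now rewrite Cexp_0.
  - rewrite S_INR, RtoC_plus. simpl pow_n. rewrite Cpow_S, IH, <- Cexp_plus. f_equal. ring.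
Qed.

Lemma derivable_pt_lim_error (f : R -> R) (x l e : R) :
  derivable_pt_lim f x l -> (0 < e)%R ->
  exists d, (0 < d)%R /\
    forall h, (Rabs h < d)%R -> (Rabs (f (x + h)%R - f x - l * h) <= e * Rabs h)%R.
Proof.
  intros H He. destruct (H e He) as [d Hd]. exists d. split; [apply cond_pos|].
  intros h Hh. destruct (Req_dec h 0) as [->|N].
  - rewrite Rplus_0_r, Rabs_R0. right.
    replace (f x - f x - l * 0)%R with 0%R by ring. rewrite Rabs_R0. ring.
  - specialize (Hd h N Hh).
    replace (f (x + h)%R - f x - l * h)%R with (((f (x + h) - f x) / h - l) * h)%R by (field; auto).
    rewrite Rabs_mult. apply Rmult_le_compat_r; [apply Rabs_pos | lra].
Qed.

Lemma cderiv_Cexp_0 : cderiv Cexp 0 1.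
Proof.
  apply cderiv_of_error. intros e0 He0.
  (* The real and the imaginary part of the error are each at most [4 e |w|]: one unit from the
     expansion or the size of [exp x - 1], three from the bound [exp x <= 3]. *)
  set (e := Rmin 1 (e0 / 8)).
  assert (He1 : (e <= 1)%R) by apply Rmin_l.
  assert (He8 : (8 * e <= e0)%R) by (pose proof (Rmin_r 1 (e0 / 8)); fold e in H; lra).
  assert (He : (0 < e)%R) by (apply Rmin_glb_lt; lra).
  destruct (derivable_pt_lim_error exp 0 1 e) as [d1 [Hd1 H1]];
    [apply derivable_pt_lim_exp_0 | exact He |].
  destruct (derivable_pt_lim_error sin 0 (cos 0) e) as [d2 [Hd2 H2]];
    [apply derivable_pt_lim_sin | exact He |].
  destruct (derivable_pt_lim_error cos 0 (- sin 0) e) as [d3 [Hd3 H3]];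
    [apply derivable_pt_lim_cos | exact He |].
  exists (Rmin (e / 2) (Rmin d1 (Rmin d2 d3))). split.
  { repeat apply Rmin_glb_lt; lra. }
  intros w Hw. replace (w - 0) with w in * by ring.
  assert (Hw0 : (Cmod w < e / 2)%R) by (eapply Rlt_le_trans; [exact Hw | apply Rmin_l]).
  assert (Hw' : (Cmod w < Rmin d1 (Rmin d2 d3))%R)
    by (eapply Rlt_le_trans; [exact Hw | apply Rmin_r]).
  assert (Hw1 : (Cmod w < d1)%R) by (eapply Rlt_le_trans; [exact Hw' | apply Rmin_l]).
  assert (Hw'' : (Cmod w < Rmin d2 d3)%R)
    by (eapply Rlt_le_trans; [exact Hw' | apply Rmin_r]).
  assert (Hw2 : (Cmod w < d2)%R) by (eapply Rlt_le_trans; [exact Hw'' | apply Rmin_l]).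
  assert (Hw3 : (Cmod w < d3)%R) by (eapply Rlt_le_trans; [exact Hw'' | apply Rmin_r]).
  pose proof (re_le_Cmod w) as Hx. pose proof (im_le_Cmod w) as Hy.
  destruct w as [x y]; simpl Re in *; simpl Im in *.
  set (m := Cmod (x, y)) in *.
  rewrite Cexp_0. specialize (H1 x ltac:(lra)). specialize (H2 y ltac:(lra)).
  specialize (H3 y ltac:(lra)).
  rewrite Rplus_0_l, exp_0, Rmult_1_l in H1. rewrite Rplus_0_l, sin_0, cos_0 in H2.
  rewrite Rplus_0_l, sin_0, cos_0 in H3.
  assert (Ex : (exp x <= 3)%R).
  { apply Rle_trans with (exp 1); [|apply exp_le_3].
    pose proof (Rle_abs x).
    destruct (Rle_lt_or_eq_dec x 1 ltac:(lra)) as [L| ->]; [left; now apply exp_increasing | lra]. }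
  pose proof (exp_pos x) as Ep.
  assert (A1 : (Rabs (exp x - 1 - x) <= e * m)%R).
  { eapply Rle_trans; [exact H1|]. apply Rmult_le_compat_l; lra. }
  assert (A3 : (Rabs (cos y - 1) <= e * m)%R).
  { replace (cos y - 1)%R with (cos y - 1 - -0 * y)%R by ring.
    eapply Rle_trans; [exact H3|]. apply Rmult_le_compat_l; lra. }
  assert (A2 : (Rabs (sin y - y) <= e * m)%R).
  { replace (sin y - y)%R with (sin y - 0 - 1 * y)%R by ring.
    eapply Rle_trans; [exact H2|]. apply Rmult_le_compat_l; lra. }
  assert (A4 : (Rabs (exp x - 1) <= e)%R).
  { replace (exp x - 1)%R with ((exp x - 1 - x) + x)%R by ring.
    eapply Rle_trans; [apply Rabs_triang|].
    assert (e * m <= 1 * m)%R by (apply Rmult_le_compat_r; [apply Cmod_ge_0 | lra]). lra. }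
  eapply Rle_trans; [apply Cmod_le_re_im|].
  assert (Hm : (0 <= m)%R) by apply Cmod_ge_0.
  assert (E0 : (8 * (e * m) <= e0 * m)%R).
  { rewrite <- Rmult_assoc. now apply Rmult_le_compat_r. }
  assert (B1 : (Rabs (Re (Cexp (x, y) - 1 - (x, y) * 1)) <= 4 * (e * m))%R).
  { replace (Re (Cexp (x, y) - 1 - (x, y) * 1))
      with ((exp x - 1 - x) + exp x * (cos y - 1))%R by (simpl; ring).
    eapply Rle_trans; [apply Rabs_triang|]. rewrite Rabs_mult, (Rabs_pos_eq (exp x)) by lra.
    assert (exp x * Rabs (cos y - 1) <= 3 * (e * m))%R
      by (apply Rmult_le_compat; try lra; apply Rabs_pos). lra. }
  assert (B2 : (Rabs (Im (Cexp (x, y) - 1 - (x, y) * 1)) <= 4 * (e * m))%R).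
  { replace (Im (Cexp (x, y) - 1 - (x, y) * 1))
      with ((exp x - 1) * y + exp x * (sin y - y))%R by (simpl; ring).
    eapply Rle_trans; [apply Rabs_triang|].
    rewrite !Rabs_mult, (Rabs_pos_eq (exp x)) by lra.
    assert (exp x * Rabs (sin y - y) <= 3 * (e * m))%R
      by (apply Rmult_le_compat; try lra; apply Rabs_pos).
    assert (Rabs (exp x - 1) * Rabs y <= e * m)%R
      by (apply Rmult_le_compat; try lra; apply Rabs_pos). lra. }
  lra.
Qed.

(** By the functional equation, the slope function at [z] is the one at 0, translated and multiplied
    by [Cexp z]. *)
Lemma cderiv_Cexp (z : C) : cderiv Cexp z (Cexp z).
Proof.
  destruct cderiv_Cexp_0 as [q [[d [Hd H]] [Hq E]]].
  exists (fun w => Cexp z * q (w - z)). split; [|split].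
  - exists d. split; [exact Hd|]. intros w Hw.
    specialize (H (w - z)). replace (w - z - 0) with (w - z) in H by ring.
    replace w with (z + (w - z)) at 1 by ring. rewrite Cexp_plus, (H Hw), Cexp_0. ring.
  - apply contw_mult; [apply contw_const|].
    apply (cont_comp q (fun w => w - z)).
    + now replace (z - z) with (RtoC 0) by ring.
    + apply contw_minus; [apply contw_id | apply contw_const].
  - replace (z - z) with (RtoC 0) by ring. rewrite E. ring.
Qed.

Lemma hol_Cexp (D : C -> Prop) : hol D Cexp.
Proof.
  exists Cexp. intros z _. split; [apply cderiv_Cexp|].
  exact (cderiv_cont _ _ _ (cderiv_Cexp z)).
Qed.

(** The bridge to real analysis: [v = 1] gives horizontal derivatives and [v = Ci] vertical ones.
    Imaginary parts are reached by applying it to [- Ci * f]. *)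
Lemma is_derive_Re_line (f : C -> C) (c : R -> C) (u0 : R) (v l : C) :
  cderiv f (c u0) l -> (forall u, c u = c u0 + RtoC (u - u0) * v) ->
  is_derive (fun u => Re (f (c u))) u0 (Re (v * l)).
Proof.
  intros [q [[d [Hd Hf]] [Hq <-]]] Hc. apply is_derive_Reals. intros e He.
  pose proof (Cmod_ge_0 v) as Hv.
  assert (He' : (0 < e / (Cmod v + 1))%R) by (apply Rdiv_lt_0_compat; lra).
  destruct (Hq _ He') as [d' [Hd' Hq']].
  assert (Hm : (0 < Rmin d d' / (Cmod v + 1))%R).
  { apply Rdiv_lt_0_compat; [|lra]. now apply Rmin_glb_lt. }
  exists (mkposreal _ Hm). intros h Hh0 Hh. simpl in Hh.
  assert (N : (Cmod (c (u0 + h)%R - c u0) < Rmin d d')%R).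
  { rewrite (Hc (u0 + h)%R). replace (u0 + h - u0)%R with h by ring.
    replace (c u0 + RtoC h * v - c u0) with (RtoC h * v) by ring.
    rewrite Cmod_mult, Cmod_R.
    apply Rmult_lt_compat_r with (r := (Cmod v + 1)%R) in Hh; [|lra].
    unfold Rdiv in Hh. rewrite Rmult_assoc, Rinv_l, Rmult_1_r in Hh by lra.
    pose proof (Rabs_pos h). lra. }
  rewrite (Hf (c (u0 + h)%R)) by (eapply Rlt_le_trans; [exact N | apply Rmin_l]).
  specialize (Hq' (c (u0 + h)%R) ltac:(eapply Rlt_le_trans; [exact N | apply Rmin_r]) I).
  set (A := q (c (u0 + h)%R)) in *.
  replace ((Re (f (c u0) + (c (u0 + h)%R - c u0) * A) - Re (f (c u0))) / h - Re (v * q (c u0)))%R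
    with (Re (v * (A - q (c u0)))).
  - eapply Rle_lt_trans; [apply re_le_Cmod|]. rewrite Cmod_mult.
    apply Rle_lt_trans with (Cmod v * (e / (Cmod v + 1)))%R.
    + apply Rmult_le_compat_l; lra.
    + apply Rlt_le_trans with ((Cmod v + 1) * (e / (Cmod v + 1)))%R.
      * apply Rmult_lt_compat_r; lra.
      * right. field. lra.
  - rewrite (Hc (u0 + h)%R). replace (u0 + h - u0)%R with h by ring.
    replace (c u0 + RtoC h * v - c u0) with (RtoC h * v) by ring.
    rewrite re_plus, <- Cmult_assoc.
    replace (Re (RtoC h * (v * A))) with (h * Re (v * A))%R by (simpl; ring).
    replace (v * (A - q (c u0))) with (v * A - v * q (c u0)) by ring.
    rewrite Re_minus. field. exact Hh0.
Qed.

Lemma cont_continuity_2d_pt (f : C -> C) (x y : R) :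
  cont f (x, y) -> continuity_2d_pt (fun u v => Re (f (u, v))) x y.
Proof.
  intros H e. destruct (H e (cond_pos e)) as [d [Hd Hf]].
  assert (Hd2 : (0 < d / 2)%R) by lra.
  exists (mkposreal _ Hd2). intros u v Hu Hv. simpl in Hu, Hv.
  rewrite <- Re_minus. eapply Rle_lt_trans; [apply re_le_Cmod|]. apply Hf; [|exact I].
  eapply Rle_lt_trans; [apply Cmod_le_re_im|]. simpl. unfold Rminus in *. lra.
Qed.

(** * Means over vertical segments *)

Lemma cont_continuous_line (f : C -> C) (x y : R) :
  cont f (x, y) -> continuous (fun t => Re (f (x, t))) y.
Proof.
  intros H P [e He]. destruct (cont_continuity_2d_pt _ _ _ H e) as [d Hd].
  exists d. intros v Hv. apply He. apply Hd; [|exact Hv].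
  replace (x - x)%R with 0%R by ring. rewrite Rabs_R0. apply cond_pos.
Qed.

Lemma ex_RInt_line (f : C -> C) (s a b : R) :
  (forall t, cont f (s, t)) -> ex_RInt (fun t => Re (f (s, t))) a b.
Proof.
  intros H. apply (@ex_RInt_continuous R_CompleteNormedModule). intros t _.
  now apply cont_continuous_line.
Qed.

(* Cauchy's theorem on the rectangle [s1, s2] x [-PI, PI], the contributions of the two
   horizontal sides cancelling by periodicity. *)
Lemma is_derive_vertical_mean (f : C -> C) (s : R) :
  hol (fun z => (Re z < 0)%R) f ->
  (forall s, (s < 0)%R -> f (s, (- PI)%R) = f (s, PI)) -> (s < 0)%R ->
  is_derive (fun s => RInt (fun t => Re (f (s, t))) (- PI) PI) s 0%R.
Proof.
  intros Hf Per Hs. pose proof (fun z => hol_cont _ _ z Hf) as Cf. destruct Hf as [f' Hf].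
  assert (Ds : forall u t, (u < 0)%R -> is_derive (fun u => Re (f (u, t))) u (Re (f' (u, t)))).
  { intros u t Hu. rewrite <- (Cmult_1_l (f' (u, t))).
    apply (is_derive_Re_line f (fun u => (u, t)) u 1); [now apply Hf|].
    intros v. apply injective_projections; simpl; ring. }
  (* Cauchy-Riemann: the derivative of [Re f] in [s] is also the derivative of [Re (- Ci * f)] in
     [t], so that its integral over [t] is a boundary term. *)
  assert (Dt : forall t, is_derive (fun t => Re (- Ci * f (s, t))) t (Re (f' (s, t)))).
  { intros t. replace (f' (s, t)) with (Ci * (- Ci * f' (s, t))).
    2:{ rewrite Cmult_assoc. replace (Ci * - Ci) with (RtoC 1); [ring|].
        apply injective_projections; simpl; ring. }
    apply (is_derive_Re_line (fun z => - Ci * f z) (fun t => (s, t)) t Ci).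
    - replace (- Ci * f' (s, t)) with (0 * f (s, t) + - Ci * f' (s, t)) by ring.
      apply (cderiv_mult (fun _ => - Ci) f); [apply cderiv_const | now apply Hf].
    - intros v. apply injective_projections; simpl; ring. }
  assert (Nb : locally s (fun u => (u < 0)%R)) by (now apply (open_lt 0 s)).
  assert (E : RInt (fun t => Derive (fun u => Re (f (u, t))) s) (- PI) PI = 0%R).
  { apply is_RInt_unique.
    replace 0%R with (minus (Re (- Ci * f (s, PI))) (Re (- Ci * f (s, (- PI)%R)))).
    2:{ rewrite Per by trivial. apply (minus_eq_zero (G := R_AbelianGroup)). }
    apply (is_RInt_ext (fun t => Re (f' (s, t)))).
    { intros t _. symmetry. apply is_derive_unique. now apply Ds. }
    apply (is_RInt_derive (fun t => Re (- Ci * f (s, t)))); intros t _; [apply Dt|].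
    apply cont_continuous_line. now apply Hf. }
  rewrite <- E. apply is_derive_RInt_param.
  - apply (filter_imp (fun u => (u < 0)%R)); [|exact Nb].
    intros u Hu t _. exists (Re (f' (u, t))). now apply Ds.
  - intros t _. apply (continuity_2d_pt_ext_loc (fun u v => Re (f' (u, v)))).
    + assert (P : (0 < - s)%R) by lra. exists (mkposreal _ P). intros u v Hu _. simpl in Hu.
      symmetry. apply is_derive_unique. apply Ds.
      pose proof (Rle_abs (u - s)). lra.
    + apply cont_continuity_2d_pt. now apply Hf.
  - apply (filter_imp (fun u => (u < 0)%R)); [|exact Nb].
    intros u Hu. apply ex_RInt_line. intros t. now apply Cf.
Qed.

Lemma vertical_mean_const (f : C -> C) (s1 s2 : R) :
  hol (fun z => (Re z < 0)%R) f ->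
  (forall s, (s < 0)%R -> f (s, (- PI)%R) = f (s, PI)) -> (s1 < s2 < 0)%R ->
  RInt (fun t => Re (f (s1, t))) (- PI) PI = RInt (fun t => Re (f (s2, t))) (- PI) PI.
Proof.
  intros Hf Per Hs.
  apply (eq_is_derive (fun s => RInt (fun t => Re (f (s, t))) (- PI) PI)); [|lra].
  intros s H. apply is_derive_vertical_mean; trivial. lra.
Qed.

Lemma Cexp_period (z : C) : Cexp (z + (0%R, (2 * PI)%R)) = Cexp z.
Proof.
  rewrite Cexp_plus. replace (Cexp (0%R, (2 * PI)%R)) with (RtoC 1); [ring|].
  unfold Cexp; simpl. rewrite exp_0, cos_2PI, sin_2PI.
  apply injective_projections; simpl; ring.
Qed.

(** * Expansions at the origin *)

Definition bounded_at_0 (f : C -> C) : Prop :=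
  exists M : R, near 0 (fun z => z <> 0 -> (Cmod (f z) <= M)%R).

(* [f z = a 0 + a 1 z + ... + a (n-1) z^(n-1) + O(z^n)] as [z] tends to [0], [z <> 0]. *)
Fixpoint jet (n : nat) (f : C -> C) (a : nat -> C) : Prop :=
  match n with
  | O => bounded_at_0 f
  | S m => jet m (fun z => (f z - a 0%nat) / z) (fun k => a (S k))
  end.

Definition punctured_disk (z : C) : Prop := z <> 0 /\ (Cmod z < 1)%R.

Lemma Cexp_punctured_disk (z : C) : (Re z < 0)%R -> punctured_disk (Cexp z).
Proof.
  intros H. split; [apply Cexp_neq_0|]. rewrite Cmod_Cexp, <- exp_0. now apply exp_increasing.
Qed.

(** The exponential maps the left half-plane onto the punctured disk and vertical segments of length
    [2 * PI] onto circles; the imaginary shift [v] rotates the circle, which is how [h] gets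
    compared with its rotation. *)
Lemma hol_lift (f : C -> C) (v : C) :
  hol punctured_disk f -> Re v = 0%R ->
  hol (fun z => (Re z < 0)%R) (fun z => f (Cexp (z + v))).
Proof.
  intros Hf Hv. apply (hol_comp _ punctured_disk f (fun z => Cexp (z + v))); trivial.
  - apply (hol_comp _ (fun _ => True) Cexp (fun z => z + v)); trivial; [apply hol_Cexp|].
    apply hol_plus; [apply hol_id | apply hol_const].
  - intros z Hz. apply Cexp_punctured_disk. rewrite re_plus. lra.
Qed.

(** A primitive in [t] is a constant multiple of the same negative power of the exponential, so it
    takes equal values at [- PI] and [PI]. *)
Lemma is_RInt_neg_power (m : nat) (a : C) (s c : R) :
  is_RInt (fun t => Re (a / Cexp ((s, t) + (0%R, c)) ^ S m)) (- PI) PI 0%R.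
Proof.
  set (k := RtoC (INR (S m))).
  assert (Hk : k <> 0).
  { unfold k. intros E. apply RtoC_inj in E. now apply (not_0_INR (S m)). }
  assert (E : forall z, / Cexp z ^ S m = Cexp (- k * z)).
  { intros z. rewrite Cexp_pow. fold k.
    assert (X : Cexp (k * z) * Cexp (- k * z) = 1).
    { rewrite <- Cexp_plus. replace (k * z + - k * z) with (RtoC 0) by ring. apply Cexp_0. }
    transitivity (/ Cexp (k * z) * (Cexp (k * z) * Cexp (- k * z))); [rewrite X; ring|].
    field. apply Cexp_neq_0. }
  set (F := fun z => a * Ci / k * Cexp (- k * (z + (0%R, c)))).
  set (G := fun z => a / Cexp (z + (0%R, c)) ^ S m).
  assert (D : forall t, is_derive (fun t => Re (F (s, t))) t (Re (G (s, t)))).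
  { intros t. replace (G (s, t)) with (Ci * (0 * Cexp (- k * ((s, t) + (0%R, c))) +
      a * Ci / k * (Cexp (- k * ((s, t) + (0%R, c))) * (- k)))).
    - apply (is_derive_Re_line F (fun t => (s, t)) t Ci).
      + apply (cderiv_mult (fun _ => a * Ci / k) (fun z => Cexp (- k * (z + (0%R, c)))));
          [apply cderiv_const|].
        apply (cderiv_comp Cexp (fun z => - k * (z + (0%R, c)))); [apply cderiv_Cexp|].
        exists (fun _ => - k). split; [|split; [apply contw_const | reflexivity]].
        apply near_all. intros w. ring.
      + intros v. apply injective_projections; simpl; ring.
    - unfold G, Cdiv. rewrite E.
      transitivity (- (Ci * Ci) * (/ k * k) * (a * Cexp (- k * ((s, t) + (0%R, c))))); [ring|].
      rewrite Cinv_l by trivial. replace (Ci * Ci) with (RtoC (-1)); [ring|].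
      apply injective_projections; simpl; ring. }
  assert (K : is_RInt (fun t => Re (G (s, t))) (- PI) PI
                (minus (Re (F (s, PI))) (Re (F (s, (- PI)%R))))).
  { apply (is_RInt_derive (fun t => Re (F (s, t))) (fun t => Re (G (s, t)))); intros t _.
    - apply D.
    - apply cont_continuous_line. unfold G.
      apply contw_mult; [apply contw_const|]. apply contw_inv; [|apply Cpow_nz, Cexp_neq_0].
      apply contw_pow.
      apply (cont_comp Cexp (fun z => z + (0%R, c))).
      + exact (cderiv_cont _ _ _ (cderiv_Cexp _)).
      + apply contw_plus; [apply contw_id | apply contw_const]. }
  replace (F (s, PI)) with (F (s, (- PI)%R)) in K.
  - rewrite (minus_eq_zero (G := R_AbelianGroup)) in K. exact K.
  - unfold F. rewrite <- !E. do 3 f_equal. rewrite <- Cexp_period. f_equal.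
    apply injective_projections; simpl; ring.
Qed.

Lemma ex_RInt_lift (f : C -> C) (s c : R) :
  hol punctured_disk f -> (s < 0)%R ->
  ex_RInt (fun t => Re (f (Cexp ((s, t) + (0%R, c))))) (- PI) PI.
Proof.
  intros Hf Hs. apply (ex_RInt_line (fun z => f (Cexp (z + (0%R, c))))). intros t.
  now apply (hol_cont _ _ _ (hol_lift f (0%R, c) Hf eq_refl)).
Qed.

(** The mean over a circle does not depend on the radius, and it tends to the value for the constant
    [a 0] as the radius shrinks, because [f z - a 0 = O(z)]. The value of [f] at 0 itself never
    enters. *)
Lemma jet0_mean (f : C -> C) (a : nat -> C) (c s : R) :
  hol punctured_disk f -> jet 1 f a -> (s < 0)%R ->
  is_RInt (fun t => Re (f (Cexp ((s, t) + (0%R, c))))) (- PI) PI (2 * PI * Re (a 0%nat))%R.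
Proof.
  intros Hf [M [d [Hd HM]]] Hs.
  pose proof PI_RGT_0 as Hpi.
  set (g := fun z => f (Cexp (z + (0%R, c)))).
  set (J := fun s => RInt (fun t => Re (g (s, t))) (- PI) PI).
  assert (EJ : forall s, (s < 0)%R -> is_RInt (fun t => Re (g (s, t))) (- PI) PI (J s)).
  { intros u Hu. apply (RInt_correct (V := R_CompleteNormedModule)). now apply ex_RInt_lift. }
  replace (2 * PI * Re (a 0%nat))%R with (J s); [now apply EJ|].
  apply NNPP. intros N.
  set (D := Rabs (J s - 2 * PI * Re (a 0%nat))).
  assert (HD : (0 < D)%R) by (apply Rabs_pos_lt; lra).
  set (K := (2 * PI * (Rabs M + 1))%R).
  assert (HK : (0 < K)%R).
  { apply Rmult_lt_0_compat; [lra|]. pose proof (Rabs_pos M). lra. }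
  (* At radii below [r] the bound on [(f z - a 0) / z] is available, and the integrated error is
     smaller than the supposed gap [D]. *)
  set (r := Rmin d (D / K)).
  assert (Hr : (0 < r)%R) by (apply Rmin_glb_lt; [exact Hd | now apply Rdiv_lt_0_compat]).
  set (u := (Rmin s (ln r) - 1)%R).
  assert (Hu : (u < s)%R) by (unfold u; pose proof (Rmin_l s (ln r)); lra).
  assert (Hur : (exp u < r)%R).
  { rewrite <- (exp_ln r) by trivial. apply exp_increasing.
    unfold u; pose proof (Rmin_r s (ln r)); lra. }
  assert (EqJ : J s = J u).
  { symmetry. apply (vertical_mean_const g); [now apply hol_lift | | lra].
    intros v Hv. unfold g. f_equal. rewrite <- Cexp_period. f_equal.
    apply injective_projections; simpl; ring. }
  pose proof (Rmin_l d (D / K)) as M1. pose proof (Rmin_r d (D / K)) as M2. fold r in M1, M2.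
  assert (B : (D <= (PI - - PI) * (Rabs M * exp u))%R).
  { unfold D. rewrite EqJ.
    pose proof (is_RInt_minus (V := R_NormedModule) _ _ _ _ _ _ (EJ u ltac:(lra))
      (is_RInt_const (- PI) PI (Re (a 0%nat) : R_NormedModule))) as X.
    apply (is_RInt_unique (V := R_CompleteNormedModule)) in X as Y.
    replace (J u - 2 * PI * Re (a 0%nat))%R
      with (RInt (fun t => minus (Re (g (u, t))) (Re (a 0%nat) : R_NormedModule)) (- PI) PI).
    2:{ etransitivity; [exact Y|]. unfold minus, plus, opp, scal; simpl; unfold mult; simpl. ring. }
    apply abs_RInt_le_const; [lra | eexists; exact X |].
    intros t _. change (Rabs (Re (g (u, t) - a 0%nat)) <= Rabs M * exp u)%R.
    eapply Rle_trans; [apply re_le_Cmod|]. unfold g.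
    set (z := Cexp ((u, t) + (0%R, c))).
    assert (Hz : Cmod z = exp u).
    { unfold z. rewrite Cmod_Cexp. f_equal. simpl. ring. }
    assert (Nz : z <> 0) by apply Cexp_neq_0.
    specialize (HM z). replace (z - 0) with z in HM by ring.
    specialize (HM ltac:(lra) Nz).
    replace (f z - a 0%nat) with ((f z - a 0%nat) / z * z) by (now field).
    rewrite Cmod_mult, Hz. apply Rmult_le_compat_r; [left; apply exp_pos|].
    pose proof (Rle_abs M). lra. }
  assert (C1 : ((PI - - PI) * (Rabs M * exp u) <= K * exp u)%R).
  { unfold K. rewrite <- Rmult_assoc. apply Rmult_le_compat_r; [left; apply exp_pos|].
    assert (2 * PI * Rabs M <= 2 * PI * (Rabs M + 1))%R by (apply Rmult_le_compat_l; lra). lra. }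
  assert (C2 : (K * exp u < K * (D / K))%R) by (apply Rmult_lt_compat_l; lra).
  replace (K * (D / K))%R with D in C2 by (field; lra). lra.
Qed.

Lemma hol_jet_tail (f : C -> C) (a : C) :
  hol punctured_disk f -> hol punctured_disk (fun z => (f z - a) / z).
Proof.
  intros Hf. apply hol_mult.
  - apply hol_minus; [exact Hf | apply hol_const].
  - apply hol_inv; [apply hol_id | now intros z [Hz _]].
Qed.

(** Cauchy's coefficient formula. Inductively, [f z / z^(n+1)] splits into [a 0 / z^(n+1)], of mean
    zero, and the tail [(f z - a 0) / z] divided by [z^n]. *)
Lemma jet_mean (n : nat) (f : C -> C) (a : nat -> C) (c s : R) :
  hol punctured_disk f -> jet (S n) f a -> (s < 0)%R ->
  is_RInt (fun t => Re (f (Cexp ((s, t) + (0%R, c))) / Cexp ((s, t) + (0%R, c)) ^ n))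
    (- PI) PI (2 * PI * Re (a n))%R.
Proof.
  revert f a. induction n as [|n IH]; intros f a Hf Hj Hs.
  - apply (is_RInt_ext (fun t => Re (f (Cexp ((s, t) + (0%R, c)))))); [|now apply jet0_mean].
    intros t _. f_equal. simpl. field.
  - pose proof (IH _ _ (hol_jet_tail f (a 0%nat) Hf) Hj Hs) as X.
    pose proof (is_RInt_plus (V := R_NormedModule) _ _ _ _ _ _
                  (is_RInt_neg_power n (a 0%nat) s c) X) as Y.
    replace (2 * PI * Re (a (S n)))%R with (plus 0%R (2 * PI * Re (a (S n)))%R)
      by apply Rplus_0_l.
    eapply is_RInt_ext; [|exact Y]. intros t _. cbv beta.
    set (z := Cexp ((s, t) + (0%R, c))).
    assert (Nz : z <> 0) by apply Cexp_neq_0.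
    pose proof (Cpow_nz z n Nz) as Nzn.
    change (Re (a 0%nat / z ^ S n + (f z - a 0%nat) / z / z ^ n) = Re (f z / z ^ S n)).
    f_equal. rewrite Cpow_S. field. auto.
Qed.

(** * Algebra of expansions at the origin *)

Lemma bounded_ext (f g : C -> C) :
  near 0 (fun z => z <> 0 -> f z = g z) -> bounded_at_0 f -> bounded_at_0 g.
Proof.
  intros E [M HM]. exists M. eapply near_imp; [|exact (near_and _ _ _ E HM)].
  intros z [H1 H2] Hz. rewrite <- H1; auto.
Qed.

Lemma jet_ext (n : nat) (f g : C -> C) (a b : nat -> C) :
  near 0 (fun z => z <> 0 -> f z = g z) -> (forall k, (k < n)%nat -> a k = b k) ->
  jet n f a -> jet n g b.
Proof.
  revert f g a b. induction n as [|n IH]; intros f g a b E Eab.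
  - now apply bounded_ext.
  - apply IH; [|intros k Hk; apply Eab; lia].
    eapply near_imp; [|exact E]. intros z Hz Nz. simpl. rewrite Hz, Eab by (trivial; lia).
    reflexivity.
Qed.

Lemma bounded_const (c : C) : bounded_at_0 (fun _ => c).
Proof. exists (Cmod c). apply near_all. intros; lra. Qed.

Lemma bounded_plus (f g : C -> C) :
  bounded_at_0 f -> bounded_at_0 g -> bounded_at_0 (fun z => f z + g z).
Proof.
  intros [M HM] [N HN]. exists (M + N)%R. eapply near_imp; [|exact (near_and _ _ _ HM HN)].
  intros z [H1 H2] Hz. specialize (H1 Hz). specialize (H2 Hz).
  pose proof (Cmod_triangle (f z) (g z)). lra.
Qed.

Lemma bounded_mult (f g : C -> C) :
  bounded_at_0 f -> bounded_at_0 g -> bounded_at_0 (fun z => f z * g z).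
Proof.
  intros [M HM] [N HN]. exists (M * N)%R. eapply near_imp; [|exact (near_and _ _ _ HM HN)].
  intros z [H1 H2] Hz. rewrite Cmod_mult.
  apply Rmult_le_compat; auto; apply Cmod_ge_0.
Qed.

Lemma bounded_cont (f : C -> C) : cont f 0 -> bounded_at_0 f.
Proof.
  intros H. exists (Cmod (f 0) + 1)%R. eapply near_imp; [|exact (contw_upper_bound _ _ _ H)].
  intros z Hz _. left. now apply Hz.
Qed.

Lemma bounded_id : bounded_at_0 (fun z => z).
Proof. apply bounded_cont, contw_id. Qed.

Lemma jet_pred (n : nat) (f : C -> C) (a : nat -> C) : jet (S n) f a -> jet n f a.
Proof.
  revert f a. induction n as [|n IH]; intros f a.
  - intros H. apply (bounded_ext (fun z => a 0%nat + (f z - a 0%nat) / z * z)).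
    + apply near_all. intros z Nz. now field.
    + apply bounded_plus; [apply bounded_const|]. apply bounded_mult; [exact H | apply bounded_id].
  - intros H. now apply IH.
Qed.

Lemma jet_plus (n : nat) (f g : C -> C) (a b : nat -> C) :
  jet n f a -> jet n g b -> jet n (fun z => f z + g z) (fun k => a k + b k).
Proof.
  revert f g a b. induction n as [|n IH]; intros f g a b Hf Hg.
  - now apply bounded_plus.
  - cbn [jet]. eapply (jet_ext n); [| |exact (IH _ _ _ _ Hf Hg)]; [|reflexivity].
    apply near_all. intros z Nz. now field.
Qed.

Lemma jet_scal (n : nat) (f : C -> C) (a : nat -> C) (c : C) :
  jet n f a -> jet n (fun z => c * f z) (fun k => c * a k).
Proof.
  revert f a. induction n as [|n IH]; intros f a Hf.
  - apply bounded_mult; [apply bounded_const | exact Hf].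
  - cbn [jet]. eapply (jet_ext n); [| |exact (IH _ _ Hf)]; [|reflexivity].
    apply near_all. intros z Nz. now field.
Qed.

Lemma jet_0 (n : nat) : jet n (fun _ => 0) (fun _ => 0).
Proof.
  induction n as [|n IH]; [apply bounded_const|].
  cbn [jet]. eapply (jet_ext n); [| |exact IH]; [|reflexivity].
  apply near_all. intros z Nz. now field.
Qed.

(** Multiplication by [z] gains one order, which [jet_pred] gives back so that applications chain at
    a fixed order. *)
Lemma jet_cons (n : nat) (f : C -> C) (a : nat -> C) (c : C) :
  jet n f a ->
  jet n (fun z => c + z * f z) (fun k => match k with O => c | S k => a k end).
Proof.
  intros H. apply jet_pred. cbn [jet]. eapply (jet_ext n); [| |exact H]; [|reflexivity].
  apply near_all. intros z Nz. now field.
Qed.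

(** The function [1 / (1 - z)] equals its own tail [(f z - 1) / z]. *)
Lemma jet_geometric (n : nat) : jet n (fun z => / (1 - z)) (fun _ => 1).
Proof.
  induction n as [|n IH].
  - apply bounded_cont. apply contw_inv.
    + apply contw_minus; [apply contw_const | apply contw_id].
    + replace (1 - 0) with (RtoC 1) by ring. intros E. apply RtoC_inj in E. lra.
  - cbn [jet]. eapply (jet_ext n); [| |exact IH]; [|reflexivity].
    exists 1%R. split; [lra|]. intros z Hz Nz. simpl.
    assert (1 - z <> 0).
    { apply Csub_neq_0. intros <-. replace (1 - 0) with (RtoC 1) in Hz by ring.
      rewrite Cmod_1 in Hz. lra. }
    now field.
Qed.

(* The sum of [a (n - j) * u j] over [j <= n]. *)
Fixpoint conv (a u : nat -> C) (n : nat) : C :=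
  match n with
  | O => a 0%nat * u 0%nat
  | S m => a (S m) * u 0%nat + conv a (fun k => u (S k)) m
  end.

Lemma jet_mult (n : nat) (f g : C -> C) (a b : nat -> C) :
  jet n f a -> jet n g b -> jet n (fun z => f z * g z) (conv a b).
Proof.
  revert f g a b. induction n as [|n IH]; intros f g a b Hf Hg.
  - now apply bounded_mult.
  - cbn [jet].
    (* The tail of a product is [b 0] times the tail of [f] plus [f] times the tail of [g]; the
       recursion of [conv] has the same shape. *)
    apply (jet_ext n (fun z => b 0%nat * ((f z - a 0%nat) / z) + f z * ((g z - b 0%nat) / z))
      _ (fun k => b 0%nat * a (S k) + conv a (fun k => b (S k)) k)).
    + apply near_all. intros z Nz. simpl. now field.
    + intros k _. simpl. ring.
    + apply jet_plus; [now apply jet_scal|]. apply IH; [now apply jet_pred | exact Hg].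
Qed.

(** The sequence [u] is arbitrary: if [g * h] has the expansion that the product would have, then
    [h] has expansion [u]. Order 0 holds because [1 / g] is bounded near 0; each further order
    passes to the tail of [h]. *)
Lemma jet_div (n : nat) (g h : C -> C) (a u : nat -> C) :
  cont g 0 -> g 0 <> 0 -> (forall k, jet k g a) ->
  jet n (fun z => g z * h z) (conv a u) -> jet n h u.
Proof.
  intros Cg N0 Hg. revert h u. induction n as [|n IH]; intros h u H.
  - apply (bounded_ext (fun z => / g z * (g z * h z))).
    + eapply near_imp; [|exact (contw_lower_bound _ _ _ Cg N0)].
      intros z Hz Nz. specialize (Hz I). pose proof (Cmod_ge_0 (g 0)).
      field. apply Cmod_gt_0. lra.
    + apply bounded_mult; [|exact H]. apply bounded_cont. now apply contw_inv.
  - apply IH.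
    cbn [jet].
    (* The identity [g * (h - u 0) / z = (g * h - a 0 * u 0) / z - u 0 * (g - a 0) / z] brings the
       tail of [h] back to known expansions. *)
    apply (jet_ext n (fun z => (g z * h z - conv a u 0) / z +
        - u 0%nat * ((g z - a 0%nat) / z))
      _ (fun k => conv a u (S k) + - u 0%nat * a (S k))).
    + apply near_all. intros z Nz. simpl. now field.
    + intros k _. simpl. ring.
    + apply jet_plus; [exact H|]. apply jet_scal. exact (Hg (S n)).
Qed.

(** * Convergent power series as expansions *)

Lemma pow_n_Cpow (z : C) (n : nat) : pow_n z n = z ^ n.
Proof. induction n as [|n IH]; simpl; [reflexivity | now rewrite IH]. Qed.

(** Convergence at [1/2] bounds the partial sums there by some [M], hence the terms by [2 M]. For
    [|z| < 1/4] the terms are then dominated by [2 M / 2^n], and the sum by [4 M]. *)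
Lemma pseries_bounded (f : C -> C) (a : nat -> C) :
  (forall z : C, z <> 0 -> (Cmod z < 1)%R ->
     is_pseries (K := C_AbsRing) (V := C_NormedModule) a z (f z)) ->
  bounded_at_0 f.
Proof.
  intros H.
  assert (Hh : RtoC (/ 2) <> 0) by (intros E; apply RtoC_inj in E; lra).
  assert (Ch : Cmod (/ 2)%R = (/ 2)%R) by (rewrite Cmod_R; apply Rabs_pos_eq; lra).
  specialize (H (/ 2)%R Hh ltac:(lra)) as H2.
  destruct (filterlim_bounded _ (ex_intro _ _ H2)) as [M HM].
  assert (HM' : forall n, (Cmod (a n) * (/ 2) ^ n <= 2 * M)%R).
  { intros n.
    replace (Cmod (a n) * (/ 2) ^ n)%R with (Cmod (pow_n (RtoC (/ 2)) n * a n)).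
    2:{ rewrite pow_n_Cpow, Cmod_mult, Cmod_pow, Ch. ring. }
    destruct n as [|n].
    - specialize (HM 0%nat). rewrite sum_O in HM.
      change (Cmod (pow_n (RtoC (/ 2)) 0 * a 0%nat) <= M)%R in HM.
      pose proof (Cmod_ge_0 (pow_n (RtoC (/ 2)) 0 * a 0%nat)). lra.
    - pose proof (HM n) as A. pose proof (HM (S n)) as B. rewrite sum_Sn in B.
      set (S0 := sum_n (fun k => scal (pow_n (RtoC (/ 2)) k) (a k)) n) in *.
      change (Cmod S0 <= M)%R in A.
      change (Cmod (S0 + pow_n (RtoC (/ 2)) (S n) * a (S n)) <= M)%R in B.
      replace (pow_n (RtoC (/ 2)) (S n) * a (S n))
        with ((S0 + pow_n (RtoC (/ 2)) (S n) * a (S n)) + - S0) by ring.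
      eapply Rle_trans; [apply Cmod_triangle|]. rewrite Cmod_opp. lra. }
  exists (4 * M)%R. exists (/ 4)%R. split; [lra|]. intros z Hz Nz.
  replace (z - 0) with z in Hz by ring.
  specialize (H z Nz ltac:(lra)).
  assert (B : forall n, (norm (sum_n (fun k => scal (pow_n z k) (a k)) n)
                         <= 2 * M * (2 - (/ 2) ^ n))%R).
  { assert (T : forall n, (Cmod (pow_n z n * a n) <= 2 * M * (/ 2) ^ n)%R).
    { intros n. rewrite pow_n_Cpow, Cmod_mult, Cmod_pow.
      assert (P : (Cmod z ^ n <= (/ 2) ^ n * (/ 2) ^ n)%R).
      { rewrite <- Rpow_mult_distr. apply pow_incr. split; [apply Cmod_ge_0 | lra]. }
      pose proof (Cmod_ge_0 (a n)).
      assert (P2 : (0 <= (/ 2) ^ n)%R) by (apply pow_le; lra).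
      apply Rle_trans with ((/ 2) ^ n * (/ 2) ^ n * Cmod (a n))%R.
      - now apply Rmult_le_compat_r.
      - replace ((/ 2) ^ n * (/ 2) ^ n * Cmod (a n))%R
          with (Cmod (a n) * (/ 2) ^ n * (/ 2) ^ n)%R by ring.
        now apply Rmult_le_compat_r. }
    induction n as [|n IH].
    - rewrite sum_O. specialize (T 0%nat).
      change (norm (scal (pow_n z 0) (a 0%nat))) with (Cmod (pow_n z 0 * a 0%nat)).
      simpl pow in *. lra.
    - rewrite sum_Sn. specialize (T (S n)).
      set (S0 := sum_n (fun k => scal (pow_n z k) (a k)) n) in *.
      change (Cmod S0 <= 2 * M * (2 - (/ 2) ^ n))%R in IH.
      change (Cmod (S0 + pow_n z (S n) * a (S n)) <= 2 * M * (2 - (/ 2) ^ S n))%R.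
      eapply Rle_trans; [apply Cmod_triangle|].
      simpl pow in T. simpl pow. lra. }
  assert (HM0 : (0 <= M)%R).
  { eapply Rle_trans; [|exact (HM 0%nat)]. apply norm_ge_0. }
  assert (L : is_lim_seq (fun n => norm (sum_n (fun k => scal (pow_n z k) (a k)) n)) (Cmod (f z))).
  { apply (filterlim_comp _ _ _ _ norm _ _ _ H). apply (filterlim_norm (f z)). }
  apply (is_lim_seq_le _ (fun _ => 4 * M)%R (Cmod (f z)) (4 * M)%R) in L;
    [exact L | | apply is_lim_seq_const].
  intros n. eapply Rle_trans; [apply B|].
  assert (P2 : (0 <= (/ 2) ^ n)%R) by (apply pow_le; lra).
  assert (0 <= M * (/ 2) ^ n)%R by now apply Rmult_le_pos. lra.
Qed.

(** The tail [(f z - a 0) / z] is again the sum of a power series, but only off 0; this is why the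
    hypothesis leaves out [z = 0]. *)
Lemma pseries_jet (n : nat) (f : C -> C) (a : nat -> C) :
  (forall z : C, z <> 0 -> (Cmod z < 1)%R ->
     is_pseries (K := C_AbsRing) (V := C_NormedModule) a z (f z)) ->
  jet n f a.
Proof.
  revert f a. induction n as [|n IH]; intros f a H.
  - exact (pseries_bounded f a H).
  - apply IH. intros z Nz Hz.
    replace ((f z - a 0%nat) / z) with (/ z * (f z - a 0%nat)) by (unfold Cdiv; ring).
    apply (is_pseries_decr_1 (K := C_AbsRing) (V := C_NormedModule) a z (/ z) (f z));
      [now apply Cinv_l | now apply H].
Qed.

(** * Compactness of the closed disk *)

(** A Lebesgue number argument for a relation that holds between any two interior points close to a
    common point of the closed disk. The covering is taken over the square containing the disk, and
    its conclusion comes doubly negated, whence the classical step. *)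
Lemma disk_lebesgue_number (P : C -> C -> Prop) :
  (forall z0, (Cmod z0 <= 1)%R ->
     exists d, (0 < d)%R /\ forall z z', (Cmod (z - z0) < d)%R -> (Cmod (z' - z0) < d)%R ->
       (Cmod z < 1)%R -> (Cmod z' < 1)%R -> P z z') ->
  exists d, (0 < d)%R /\ forall z z', (Cmod z < 1)%R -> (Cmod z' < 1)%R ->
    (Cmod (z - z') < d)%R -> P z z'.
Proof.
  intros H.
  (* The factor 4 leaves room for the square neighbourhoods: [z] is within [2 d] of the centre and
     [z'] within [3 d]. Outside the closed disk the radius is chosen so that the ball misses the
     open disk. *)
  assert (K : forall u v, exists d : posreal, forall z z',
    (Cmod (z - (u, v)) < 4 * d)%R -> (Cmod (z' - (u, v)) < 4 * d)%R ->
    (Cmod z < 1)%R -> (Cmod z' < 1)%R -> P z z').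
  { intros u v. destruct (Rle_lt_dec (Cmod (u, v)) 1) as [L|L].
    - destruct (H (u, v) L) as [d [Hd Hz]].
      assert (P4 : (0 < d / 4)%R) by lra. exists (mkposreal _ P4). simpl.
      intros z z' H1 H2. apply Hz; lra.
    - assert (P4 : (0 < (Cmod (u, v) - 1) / 4)%R) by lra. exists (mkposreal _ P4). simpl.
      intros z z' H1 _ H3. pose proof (Cmod_le_sub (u, v) z) as T.
      rewrite Cmod_sub_sym in T. lra. }
  set (delta := fun u v => proj1_sig (constructive_indefinite_description _ (K u v))).
  destruct (compactness_value_2d (-1) 1 (-1) 1 delta) as [d Hd].
  exists d. split; [apply cond_pos|]. intros z z' Hz Hz' Hzz.
  assert (Rz := re_le_Cmod z). assert (Iz := im_le_Cmod z).
  apply NNPP. intros N. apply (Hd (Re z) (Im z)).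
  1,2: apply Rabs_le_between; lra.
  intros [u [v [_ [_ [Hu [Hv Hduv]]]]]]. apply N.
  unfold delta in *. destruct (constructive_indefinite_description _ (K u v)) as [e He].
  cbn [proj1_sig] in *.
  assert (Z0 : (Cmod (z - (u, v)) < 2 * e)%R).
  { eapply Rle_lt_trans; [apply Cmod_le_re_im|].
    change (Rabs (Re z - u) + Rabs (Im z - v) < 2 * e)%R. lra. }
  apply He; trivial; [pose proof (cond_pos e); lra|].
  pose proof (Cmod_sub_triangle z' z (u, v)) as T. rewrite (Cmod_sub_sym z' z) in T.
  pose proof (cond_pos e). lra.
Qed.

(** * Weighted modulus of continuity and Fourier coefficients *)

Definition weight (g : R) (z : C) : R := Rpower (Cmod (1 - z)) (- g).

Lemma Rpower_le_opp (x y g : R) : (0 < x <= y)%R -> (0 <= g)%R ->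
  (Rpower y (- g) <= Rpower x (- g))%R.
Proof.
  intros Hx Hg. unfold Rpower.
  assert (L : (ln x <= ln y)%R) by (apply ln_le; lra).
  assert (E : (- g * ln y <= - g * ln x)%R) by nra.
  destruct (Rle_lt_or_eq_dec _ _ E) as [L'|E']; [left; now apply exp_increasing | rewrite E'; lra].
Qed.

Lemma unit_disk_sub_pos (z : C) : (Cmod z < 1)%R -> (0 < Cmod (1 - z))%R.
Proof.
  intros H. pose proof (Cmod_le_sub 1 z). rewrite Cmod_1 in H0. lra.
Qed.

(** Near 1 both values are separately below [eta] times the weight, and no closeness is used.
    Elsewhere [h] has a limit at each boundary point and the weight is bounded below, so plain
    continuity suffices; compactness makes the distance uniform. *)
Lemma weighted_modulus (h : C -> C) (g eta : R) :
  (0 <= g)%R -> (0 < eta)%R ->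
  (forall z0, (Cmod z0 <= 1)%R -> z0 <> 1 -> contw (fun z => (Cmod z < 1)%R) h z0) ->
  near 1 (fun z => (Cmod z < 1)%R -> (Cmod (h z) <= eta * weight g z)%R) ->
  exists d, (0 < d)%R /\ forall z z', (Cmod z < 1)%R -> (Cmod z' < 1)%R ->
    (Cmod (z - z') < d)%R -> (Cmod (h z - h z') <= eta * (weight g z + weight g z'))%R.
Proof.
  intros Hg He Hc H1.
  apply (disk_lebesgue_number (fun z z' =>
    (Cmod (h z - h z') <= eta * (weight g z + weight g z'))%R)).
  intros z0 Hz0. destruct (classic (z0 = 1)) as [->|N].
  - destruct H1 as [d [Hd H]]. exists d. split; [exact Hd|]. intros z z' A B Dz Dz'.
    specialize (H z A Dz) as X. specialize (H z' B Dz').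
    pose proof (Cmod_triangle (h z) (- h z')) as T. rewrite Cmod_opp in T.
    unfold Cminus. lra.
  (* The lower bound of the weight on the disk, where [|1 - z| <= 2]. *)
  - set (w0 := Rpower 2 (- g)).
    assert (W0 : (0 < w0)%R) by apply exp_pos.
    assert (W : forall z, (Cmod z < 1)%R -> (w0 <= weight g z)%R).
    { intros z Hz. apply Rpower_le_opp; [|exact Hg]. split; [now apply unit_disk_sub_pos|].
      pose proof (Cmod_triangle 1 (- z)) as T. rewrite Cmod_opp, Cmod_1 in T.
      unfold Cminus. lra. }
    destruct (Hc z0 Hz0 N (eta * w0)%R (Rmult_lt_0_compat _ _ He W0)) as [d [Hd H]].
    exists d. split; [exact Hd|]. intros z z' A B Dz Dz'.
    specialize (H z A Dz) as X. specialize (H z' B Dz') as Y.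
    pose proof (Cmod_sub_triangle (h z) (h z0) (h z')) as T.
    rewrite (Cmod_sub_sym (h z0)) in T.
    assert (eta * w0 <= eta * weight g z)%R by (apply Rmult_le_compat_l; [lra | auto]).
    assert (eta * w0 <= eta * weight g z')%R by (apply Rmult_le_compat_l; [lra | auto]).
    lra.
Qed.

(** * The weight on circles close to the unit circle *)

(** From [sin u >= u - u^3 / 6]: on this range [1 - u^2 / 6 >= 1 - 4.84 / 6 > 2 / 11]. The range is
    half of [4.4], which bounds [PI + PI / n] for [n > 10] with the crude estimate [PI <= 4]. *)
Lemma sin_ge_linear (u : R) : (0 <= u <= 22 / 10)%R -> (2 * u <= 11 * sin u)%R.
Proof.
  intros Hu. destruct (pre_sin_bound u 0 ltac:(lra) ltac:(lra)) as [L _].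
  assert (E : sin_approx u (2 * 0 + 1) = (u - u * u * u / 6)%R).
  { unfold sin_approx, sin_term. simpl. field. }
  rewrite E in L. assert (u * (u * u) <= u * (484 / 100))%R by nra. lra.
Qed.

Lemma Cmod_one_sub_Cexp (s x : R) :
  Cmod (1 - Cexp (s, x)) = sqrt ((1 - exp s) ^ 2 + 4 * exp s * sin (x / 2) ^ 2).
Proof.
  unfold Cmod. f_equal. simpl.
  replace x with (2 * (x / 2))%R at 1 2 3 4 by field. rewrite cos_2a_sin, sin_2a.
  pose proof (sin2_cos2 (x / 2)) as H. unfold Rsqr in H.
  transitivity ((1 - exp s) ^ 2 + 4 * exp s * sin (x / 2) ^ 2 +
    4 * (exp s) ^ 2 * sin (x / 2) ^ 2 *
      (sin (x / 2) * sin (x / 2) + cos (x / 2) * cos (x / 2) - 1))%R; [ring|].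
  rewrite H. ring.
Qed.

(** With [d = 1 - exp s] and [y = |sin (x/2)|], [|x| <= 11 y] and [(d + 11 y)^2 <= 2 d^2 + 242 y^2],
    which is below [400 (d^2 + 2 y^2)]; the factor 2 in front of [y^2] uses [exp s >= 1/2]. *)
Lemma Cmod_one_sub_Cexp_ge (s x : R) :
  (/ 2 <= exp s <= 1)%R -> (Rabs x <= 44 / 10)%R ->
  ((1 - exp s) + Rabs x <= 20 * Cmod (1 - Cexp (s, x)))%R.
Proof.
  intros Hs Hx.
  assert (S : (Rabs x <= 11 * Rabs (sin (x / 2)))%R).
  { replace (Rabs x) with (2 * Rabs (x / 2))%R.
    2:{ unfold Rdiv. rewrite Rabs_mult, (Rabs_pos_eq (/ 2)) by lra. field. }
    assert (B : (Rabs (x / 2) <= 22 / 10)%R).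
    { unfold Rdiv. rewrite Rabs_mult, (Rabs_pos_eq (/ 2)); lra. }
    destruct (Rle_lt_dec 0 (x / 2)) as [P|P].
    - rewrite (Rabs_pos_eq (x / 2)) in * by trivial.
      eapply Rle_trans; [apply sin_ge_linear; lra|]. pose proof (Rle_abs (sin (x / 2))). lra.
    - rewrite (Rabs_left (x / 2)) in * by trivial.
      eapply Rle_trans; [apply sin_ge_linear; lra|]. rewrite sin_neg.
      pose proof (Rle_abs (- sin (x / 2))) as T. rewrite Rabs_Ropp in T. lra. }
  rewrite Cmod_one_sub_Cexp. pose proof (pow2_abs (sin (x / 2))) as Q.
  set (y := Rabs (sin (x / 2))) in *.
  assert (Hy : (0 <= y)%R) by apply Rabs_pos.
  apply Rle_trans with ((1 - exp s) + 11 * y)%R; [lra|].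
  rewrite <- Q.
  replace 20%R with (sqrt (20 * 20)) by (apply sqrt_square; lra).
  rewrite <- sqrt_mult_alt by lra.
  rewrite <- (sqrt_pow2 (1 - exp s + 11 * y)) by lra.
  apply sqrt_le_1_alt. assert (/ 2 * y ^ 2 <= exp s * y ^ 2)%R.
  { apply Rmult_le_compat_r; [apply pow2_ge_0 | lra]. }
  pose proof (pow2_ge_0 (1 - exp s - 11 * y)). pose proof (pow2_ge_0 (1 - exp s)).
  pose proof (pow2_ge_0 y). nra.
Qed.

(** Here [sg] is the sign of [t + c] on the whole interval, so the absolute value is affine and the
    primitive explicit; the two signs serve the two sides of [t = - c]. *)
Lemma is_RInt_Rpower_affine (g e sg c a b : R) :
  (g < 1)%R -> (sg = 1 \/ sg = -1)%R -> (0 < e)%R ->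
  (forall t, Rmin a b <= t <= Rmax a b -> 0 <= sg * (t + c))%R ->
  is_RInt (fun t => Rpower (e + Rabs (t + c)) (- g)) a b
    (sg * (Rpower (e + sg * (b + c)) (1 - g) - Rpower (e + sg * (a + c)) (1 - g)) / (1 - g))%R.
Proof.
  intros Hg Hsg He Ht.
  assert (Sg : (sg * sg = 1)%R) by (destruct Hsg; subst; ring).
  set (F := fun t => (sg * Rpower (e + sg * (t + c)) (1 - g) / (1 - g))%R).
  assert (X : is_RInt (fun t => Rpower (e + sg * (t + c)) (- g)) a b (minus (F b) (F a))).
  { apply (is_RInt_derive F).
    - intros t H. specialize (Ht t H). unfold F.
      assert (P : (0 < e + sg * (t + c))%R) by lra.
      assert (E : Rpower (e + sg * (t + c)) (- g) =
        (Rpower (e + sg * (t + c)) (1 - g) * / (e + sg * (t + c)))%R).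
      { replace (/ (e + sg * (t + c)))%R with (Rpower (e + sg * (t + c)) (- (1)))
          by (rewrite Rpower_Ropp, Rpower_1; trivial).
        rewrite <- Rpower_plus. f_equal. ring. }
      rewrite E. unfold Rpower. auto_derive; [lra|].
      set (X := exp ((1 - g) * ln (e + sg * (t + c)))%R).
      transitivity (sg * sg * X * / (e + sg * (t + c)))%R; [field; lra|].
      rewrite Sg. ring.
    - intros t H. specialize (Ht t H).
      apply (ex_derive_continuous (fun t => Rpower (e + sg * (t + c)) (- g))).
      unfold Rpower. auto_derive. lra. }
  replace (sg * (Rpower (e + sg * (b + c)) (1 - g) - Rpower (e + sg * (a + c)) (1 - g))
             / (1 - g))%R with (minus (F b) (F a)).
  - revert X. apply is_RInt_ext. intros t H. specialize (Ht t ltac:(lra)).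
    f_equal. f_equal.
    destruct Hsg; subst sg; [rewrite Rabs_pos_eq | rewrite Rabs_left1]; lra.
  - unfold F, minus, plus, opp; simpl. field. lra.
Qed.

Lemma Rpower_le_base (x y b : R) : (0 < x <= y)%R -> (0 <= b)%R -> (Rpower x b <= Rpower y b)%R.
Proof.
  intros Hx Hb. destruct Hb as [Hb|<-]; [now apply Rle_Rpower_l; [left|] |].
  rewrite !Rpower_O by lra. lra.
Qed.

(** The point is the uniformity in [e], which will be 1 minus the radius, and in the rotation angle
    [c]. *)
Lemma weight_integral (g : R) :
  (0 <= g < 1)%R -> exists K, (0 < K)%R /\ forall e c, (0 < e <= 1)%R -> (0 <= c <= 4 / 10)%R ->
    exists V, (V <= K)%R /\
      is_RInt (fun t => Rpower (e + Rabs (t + c)) (- g)) (- PI) PI V.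
Proof.
  (* Each side of [t = - c] contributes at most [6^(1-g) / (1-g)], since
     [e + |t + c| <= 1 + 4 + 0.4 < 6]; the terms at [t = - c] enter with a negative sign. *)
  intros Hg. exists (2 * Rpower 6 (1 - g) / (1 - g))%R. split.
  { apply Rdiv_lt_0_compat; [|lra]. apply Rmult_lt_0_compat; [lra | apply exp_pos]. }
  intros e c He Hc. pose proof PI_4 as P4. pose proof PI2_3_2 as P3.
  assert (L : (Rmin (- PI) (- c) = - PI /\ Rmax (- PI) (- c) = - c)%R).
  { split; [apply Rmin_left | apply Rmax_right]; lra. }
  assert (L' : (Rmin (- c) PI = - c /\ Rmax (- c) PI = PI)%R).
  { split; [apply Rmin_left | apply Rmax_right]; lra. }
  eexists. split; [|eapply (is_RInt_Chasles (V := R_NormedModule) _ (- PI)%R (- c)%R PI)].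
  2:{ apply (is_RInt_Rpower_affine g e (-1) c); try lra. intros t Ht. lra. }
  2:{ apply (is_RInt_Rpower_affine g e 1 c); try lra. intros t Ht. lra. }
  unfold plus; simpl.
  assert (A : (Rpower (e + -1 * (- PI + c)) (1 - g) <= Rpower 6 (1 - g))%R)
    by (apply Rpower_le_base; lra).
  assert (B : (Rpower (e + 1 * (PI + c)) (1 - g) <= Rpower 6 (1 - g))%R)
    by (apply Rpower_le_base; lra).
  pose proof (exp_pos ((1 - g) * ln (e + -1 * (- c + c)))) as Cc.
  pose proof (exp_pos ((1 - g) * ln (e + 1 * (- c + c)))) as Dd.
  fold (Rpower (e + -1 * (- c + c)) (1 - g)) in Cc. fold (Rpower (e + 1 * (- c + c)) (1 - g)) in Dd.
  unfold Rdiv. rewrite <- Rmult_plus_distr_r. apply Rmult_le_compat_r; [|lra].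
  left. apply Rinv_0_lt_compat. lra.
Qed.

(** * Decay of the coefficients *)

Lemma coef_Re_to_0 (h : C -> C) (u : nat -> C) (g : R) :
  (0 <= g < 1)%R -> hol punctured_disk h -> (forall n, jet n h u) ->
  (forall eta, (0 < eta)%R -> exists d, (0 < d)%R /\
     forall z z', (Cmod z < 1)%R -> (Cmod z' < 1)%R -> (Cmod (z - z') < d)%R ->
       (Cmod (h z - h z') <= eta * (weight g z + weight g z'))%R) ->
  forall e, (0 < e)%R -> exists N, forall n, (N <= n)%nat -> (Rabs (Re (u n)) <= e)%R.
Proof.
  intros Hg Hh Hj Hm e He. pose proof PI_RGT_0 as Hpi. pose proof PI_4 as P4.
  pose proof PI2_3_2 as P3.
  destruct (weight_integral g Hg) as [K [HK HW]].
  set (k := Rpower (/ 20) (- g)). assert (Hk : (0 < k)%R) by apply exp_pos.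
  (* The three factors are the losses to come: [exp 1] from the [n]-th power of the radius, [k] from
     replacing the weight by a power of [1 - exp s + |x|], and [K] from its integral. *)
  set (eta := (e / (exp 1 * k * K))%R).
  assert (Hden : (0 < exp 1 * k * K)%R).
  { repeat apply Rmult_lt_0_compat; trivial. apply exp_pos. }
  assert (Heta : (0 < eta)%R) by now apply Rdiv_lt_0_compat.
  destruct (Hm eta Heta) as [d [Hd Hmod]].
  destruct (cderiv_cont _ _ _ cderiv_Cexp_0 d Hd) as [d' [Hd' Hexp]].
  (* The 10 keeps the angle [PI / n] below [4/10] and the radius above [1/2]; the term [PI / d']
     makes the rotation move points by less than [d]. *)
  destruct (nfloor_ex (10 + PI / d')) as [N [_ HN]].
  { pose proof (Rdiv_lt_0_compat _ _ Hpi Hd'). lra. }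
  exists (S N). intros n Hn.
  assert (Hn' : (10 + PI / d' < INR n)%R).
  { eapply Rlt_le_trans; [exact HN|]. rewrite <- S_INR. now apply le_INR. }
  pose proof (Rdiv_lt_0_compat _ _ Hpi Hd') as Hpd.
  set (c := (PI / INR n)%R). set (s := (- / INR n)%R).
  assert (Hin : (0 < / INR n <= / 10)%R).
  { split; [apply Rinv_0_lt_compat; lra | apply Rinv_le_contravar; lra]. }
  assert (Hc : (0 <= c <= 4 / 10)%R).
  { unfold c, Rdiv at 1 2. nra. }
  assert (Hcd : (c < d')%R).
  { unfold c. apply Rmult_lt_reg_r with (INR n); [lra|]. unfold Rdiv.
    rewrite Rmult_assoc, Rinv_l, Rmult_1_r by lra.
    replace PI with (d' * (PI / d'))%R at 1 by (field; lra). apply Rmult_lt_compat_l; lra. }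
  assert (Hs : (s < 0)%R) by (unfold s; lra).
  assert (Hes : (/ 2 <= exp s < 1)%R).
  { split.
    - pose proof (exp_ineq1_le s). unfold s in *. lra.
    - rewrite <- exp_0. now apply exp_increasing. }
  (* Coefficient [n] requires the expansion up to an error [O(z^(n+1))], hence [S n]. *)
  pose proof (jet_mean n h u 0 s Hh (Hj (S n)) Hs) as I0.
  pose proof (jet_mean n h u c s Hh (Hj (S n)) Hs) as I1.
  (* The points of the second integral are those of the first rotated by [PI / n], which
     changes the sign of the [n]-th power: the sum of the integrands is that of [h z - h z']. *)
  pose proof (is_RInt_plus (V := R_NormedModule) _ _ _ _ _ _ I0 I1) as I2.
  destruct (HW (1 - exp s)%R 0%R) as [V0 [HV0 IV0]]; [lra | lra |].
  destruct (HW (1 - exp s)%R c) as [V1 [HV1 IV1]]; [lra | lra |].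
  pose proof (is_RInt_scal (V := R_NormedModule) _ _ _ (eta * exp 1 * k)%R _
    (is_RInt_plus (V := R_NormedModule) _ _ _ _ _ _ IV0 IV1)) as I3.
  assert (Fin : (Rabs (2 * PI * Re (u n) + 2 * PI * Re (u n)) <= eta * exp 1 * k * (V0 + V1))%R).
  { refine (norm_RInt_le _ _ _ _ _ _ _ _ I2 I3); [lra|]. intros t Ht. cbv beta.
    set (z := Cexp ((s, t) + (0%R, 0%R))). set (z' := Cexp ((s, t) + (0%R, c))).
    assert (Ez : Cmod z = exp s) by (unfold z; rewrite Cmod_Cexp; f_equal; simpl; ring).
    assert (Ez' : Cmod z' = exp s) by (unfold z'; rewrite Cmod_Cexp; f_equal; simpl; ring).
    assert (Nz : z <> 0) by apply Cexp_neq_0.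
    pose proof (Cpow_nz z n Nz) as Nzn.
    assert (Zz : z' = z * Cexp (0%R, c)).
    { unfold z, z'. rewrite <- Cexp_plus. f_equal. apply injective_projections; simpl; ring. }
    assert (Zn : z' ^ n = - z ^ n).
    { rewrite Zz, Cpow_mult_l, Cexp_pow.
      replace (RtoC (INR n) * (0%R, c)) with (0%R, PI).
      - unfold Cexp; simpl. rewrite exp_0, cos_PI, sin_PI.
        replace (1 * -1, 1 * 0)%R with (RtoC (-1)); [ring|].
        apply injective_projections; simpl; ring.
      - unfold c. apply injective_projections; simpl; field; lra. }
    assert (D : (Cmod (z - z') < d)%R).
    { replace (z - z') with (- z * (Cexp (0%R, c) - 1)) by (rewrite Zz; ring).
      rewrite Cmod_mult, Cmod_opp, Ez.
      specialize (Hexp (0%R, c)). rewrite Cexp_0 in Hexp.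
      assert (Q : (Cmod (Cexp (0%R, c) - 1) < d)%R).
      { apply Hexp; [|exact I]. eapply Rle_lt_trans; [apply Cmod_le_re_im|]. simpl.
        rewrite !Rplus_0_l, Ropp_0, !Rplus_0_r, Rabs_R0, (Rabs_pos_eq c) by lra. lra. }
      pose proof (Cmod_ge_0 (Cexp (0%R, c) - 1)).
      apply Rle_lt_trans with (1 * Cmod (Cexp (0%R, c) - 1))%R; [|lra].
      apply Rmult_le_compat_r; lra. }
    assert (M : (Cmod (h z - h z') <= eta * (weight g z + weight g z'))%R).
    { apply Hmod; lra. }
    assert (W : forall x, (Rabs x <= 44 / 10)%R ->
      (weight g (Cexp (s, x)) <= k * Rpower (1 - exp s + Rabs x) (- g))%R).
    { intros x Hx. unfold k, weight. rewrite Rpower_mult_distr; [|lra|pose proof (Rabs_pos x); lra].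
      apply Rpower_le_opp; [|lra]. pose proof (Rabs_pos x).
      pose proof (Cmod_one_sub_Cexp_ge s x ltac:(lra) Hx). lra. }
    assert (W0 : (weight g z <= k * Rpower (1 - exp s + Rabs (t + 0)) (- g))%R).
    { unfold z. replace ((s, t) + (0%R, 0%R)) with (s, (t + 0)%R).
      - apply W. apply Rabs_le. lra.
      - apply injective_projections; simpl; ring. }
    assert (W1 : (weight g z' <= k * Rpower (1 - exp s + Rabs (t + c)) (- g))%R).
    { unfold z'. replace ((s, t) + (0%R, c)) with (s, (t + c)%R).
      - apply W. apply Rabs_le. lra.
      - apply injective_projections; simpl; ring. }
    change (Rabs (Re (h z / z ^ n) + Re (h z' / z' ^ n)) <= eta * exp 1 * k *
      (Rpower (1 - exp s + Rabs (t + 0)) (- g) + Rpower (1 - exp s + Rabs (t + c)) (- g)))%R.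
    rewrite <- re_plus. eapply Rle_trans; [apply re_le_Cmod|].
    replace (h z / z ^ n + h z' / z' ^ n) with ((h z - h z') / z ^ n).
    2:{ rewrite Zn. field. exact Nzn. }
    rewrite Cmod_div by trivial. rewrite Cmod_pow, Ez.
    replace (exp s ^ n)%R with (/ exp 1)%R.
    2:{ rewrite <- exp_Ropp, <- Rpower_pow by apply exp_pos. unfold Rpower. rewrite ln_exp.
        f_equal. unfold s. field. lra. }
    unfold Rdiv. rewrite Rinv_inv, Rmult_comm.
    replace (eta * exp 1 * k * (Rpower (1 - exp s + Rabs (t + 0)) (- g) +
      Rpower (1 - exp s + Rabs (t + c)) (- g)))%R
      with (exp 1 * (eta * (k * Rpower (1 - exp s + Rabs (t + 0)) (- g) +
              k * Rpower (1 - exp s + Rabs (t + c)) (- g))))%R by ring.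
    apply Rmult_le_compat_l; [left; apply exp_pos|].
    eapply Rle_trans; [exact M|]. apply Rmult_le_compat_l; lra. }
  replace (2 * PI * Re (u n) + 2 * PI * Re (u n))%R with (4 * PI * Re (u n))%R in Fin by ring.
  rewrite Rabs_mult, (Rabs_pos_eq (4 * PI)) in Fin by lra.
  assert (F2 : (eta * exp 1 * k * (V0 + V1) <= 2 * e)%R).
  { replace (2 * e)%R with (eta * exp 1 * k * (2 * K))%R
      by (unfold eta; field; pose proof (exp_pos 1); repeat split; lra).
    apply Rmult_le_compat_l; [|lra]. left.
    apply Rmult_lt_0_compat; [apply Rmult_lt_0_compat; [exact Heta | apply exp_pos] | exact Hk]. }
  pose proof (Rabs_pos (Re (u n))). nra.
Qed.

(** * The generating functions *)

Definition disk (z : C) : Prop := (Cmod z < 1)%R.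
Definition closed_disk (z : C) : Prop := (Cmod z <= 1)%R.

Lemma disk_open (z : C) : disk z -> near z disk.
Proof. apply near_Cmod_lt. Qed.

Lemma contw_sub (D E : C -> Prop) (f : C -> C) (z : C) :
  (forall w, E w -> D w) -> contw D f z -> contw E f z.
Proof. intros H Hf e He. eapply near_imp; [|exact (Hf e He)]. simpl; auto. Qed.

Lemma disk_sub_closed (z : C) : disk z -> closed_disk z.
Proof. unfold disk, closed_disk; lra. Qed.

(** The balls of the uniform structure on [C] are squares: a square of half-width [e / 2] lies in
    the disk of radius [e], and a disk of radius [d] lies in the square of half-width [d]. *)
Lemma contw_of_continuous (f : C -> C) (z : C) :
  continuous_on_closed_disk f -> closed_disk z -> contw closed_disk f z.
Proof.
  intros H Hz e He. assert (He2 : (0 < e / 2)%R) by lra.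
  destruct (H z Hz (fun y => (Cmod (y - f z) < e)%R)) as [d Hd].
  - exists (mkposreal _ He2). intros y [H1 H2].
    change (Rabs (Re (y - f z)) < e / 2)%R in H1. change (Rabs (Im (y - f z)) < e / 2)%R in H2.
    eapply Rle_lt_trans; [apply Cmod_le_re_im | lra].
  - exists d. split; [apply cond_pos|]. intros w Hw Dw. apply Hd; [|exact Dw].
    split.
    + eapply Rle_lt_trans; [exact (re_le_Cmod (w - z)) | exact Hw].
    + eapply Rle_lt_trans; [exact (im_le_Cmod (w - z)) | exact Hw].
Qed.

(* Since [f = exp L], the derivative of [g = exp (alpha * L)] is [alpha * f' / f * g], which
   is continuous although nothing is known about the derivative of [L]. *)
Lemma power_branch_hol (f g : C -> C) (alpha : R) :
  hol disk f -> power_branch f alpha g -> hol disk g.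
Proof.
  intros Hf [[L HL] _].
  assert (Nf : forall z, disk z -> f z <> 0).
  { intros z Hz. destruct (HL z Hz) as [_ [<- _]]. apply Cexp_neq_0. }
  assert (Dg : forall f', (forall z, disk z -> cderiv f z (f' z)) ->
    forall z, disk z -> cderiv g z (g z * (RtoC alpha * (f' z * / f z)))).
  { intros f' Hf' z Hz. destruct (HL z Hz) as [E [Ef Eg]].
    destruct (cderiv_of_ex_Cderive L z E) as [l Hl].
    assert (El : f' z * / f z = l).
    { replace (f' z) with (Cexp (L z) * l).
      - rewrite Ef. field. now apply Nf.
      - apply (cderiv_unique f z); [|now apply Hf'].
        apply (cderiv_ext_near (fun w => Cexp (L w))).
        + eapply near_imp; [|exact (disk_open z Hz)]. intros w Hw. now apply HL.
        + apply cderiv_comp; [apply cderiv_Cexp | exact Hl]. }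
    rewrite El, Eg. apply (cderiv_ext_near (fun w => Cexp (RtoC alpha * L w))).
    + eapply near_imp; [|exact (disk_open z Hz)]. intros w Hw. symmetry. now apply HL.
    + apply (cderiv_comp Cexp (fun w => RtoC alpha * L w)); [apply cderiv_Cexp|].
      replace (RtoC alpha * l) with (0 * L z + RtoC alpha * l) by ring.
      apply (cderiv_mult (fun _ => RtoC alpha) L); [apply cderiv_const | exact Hl]. }
  pose proof (fun z => hol_cont _ _ z Hf) as Cf. destruct Hf as [f' Hf].
  specialize (Dg f' (fun z Hz => proj1 (Hf z Hz))).
  exists (fun z => g z * (RtoC alpha * (f' z * / f z))). intros z Hz.
  split; [now apply Dg|].
  apply contw_mult; [exact (cderiv_cont _ _ _ (Dg z Hz))|].
  apply contw_mult; [apply contw_const|].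
  apply contw_mult; [now apply Hf|]. apply contw_inv; [now apply Cf | now apply Nf].
Qed.

(** As [alpha] is real, [|exp (alpha L)| = exp (alpha Re L)], whatever branch [L] is. *)
Lemma power_branch_Cmod (f g : C -> C) (alpha : R) (z : C) :
  power_branch f alpha g -> disk z -> f z <> 0 /\ Cmod (g z) = Rpower (Cmod (f z)) alpha.
Proof.
  intros [[L HL] _] Hz. destruct (HL z Hz) as [_ [<- ->]]. split; [apply Cexp_neq_0|].
  rewrite !Cmod_Cexp. unfold Rpower. rewrite ln_exp. f_equal. unfold Re. simpl. ring.
Qed.

Lemma hol_sum (F : nat -> C -> C) (p : nat) :
  (forall k, hol (fun _ => True) (F k)) ->
  hol (fun _ => True) (fun z => sum_n_m (fun k => F k z) 1 p).
Proof.
  intros H. assert (Op : forall z : C, True -> near z (fun _ => True))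
    by (intros; now apply near_all).
  induction p as [|p IH].
  - apply (hol_ext _ (fun _ => 0)); [exact Op | | apply hol_const].
    intros z _. rewrite sum_n_m_zero by lia. reflexivity.
  - apply (hol_ext _ (fun z => sum_n_m (fun k => F k z) 1 p + F (S p) z)); [exact Op | |].
    + intros z _. rewrite sum_n_Sm by lia. reflexivity.
    + now apply hol_plus.
Qed.

Lemma hol_one_sub (D : C -> Prop) : hol D (fun z => 1 - z).
Proof. apply hol_minus; [apply hol_const | apply hol_id]. Qed.

Definition order_alpha_at_1 (alpha : R) (f : C -> C) : Prop :=
  exists K, (0 < K)%R /\
    near 1 (fun z => disk z -> (Cmod (f z) <= K * Rpower (Cmod (1 - z)) alpha)%R).

Lemma hol_bounded_at_1 (P : C -> C) :
  hol (fun _ => True) P ->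
  exists M, (0 < M)%R /\ near 1 (fun z => (Cmod (P z) <= M)%R).
Proof.
  intros HP. exists (Cmod (P 1) + 1)%R. split; [pose proof (Cmod_ge_0 (P 1)); lra|].
  eapply near_imp; [|exact (contw_upper_bound _ _ _ (hol_cont _ _ 1 HP I))].
  intros z Hz. left. now apply Hz.
Qed.

(** Every term of the symbol contains a factor [1 - z]; taking it out leaves a polynomial [P],
    bounded near 1, and the modulus of the power gives the order [alpha]. *)
Lemma fbdf_regularity (p : nat) (alpha : R) (omega : C -> C) :
  (0 <= alpha)%R -> is_fbdf p alpha omega ->
  hol disk omega /\ (forall z, closed_disk z -> contw closed_disk omega z) /\
  order_alpha_at_1 alpha omega.
Proof.
  intros Ha H.
  set (P := fun z => sum_n_m (fun k => / RtoC (INR k) * (1 - z) ^ (k - 1)) 1 p).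
  assert (HP : hol (fun _ => True) P).
  { apply (hol_sum (fun k z => / RtoC (INR k) * (1 - z) ^ (k - 1))). intros k.
    apply hol_mult; [apply hol_const | apply hol_pow, hol_one_sub]. }
  assert (E : forall z, bdf_symbol p z = (1 - z) * P z).
  { intros z. unfold bdf_symbol, P.
    rewrite <- (sum_n_m_mult_l (K := C_Ring) (1 - z)). apply sum_n_m_ext_loc.
    intros k [Hk _]. destruct k as [|k]; [lia|].
    replace (S k - 1)%nat with k by lia. rewrite Cpow_S.
    change (/ RtoC (INR (S k)) * ((1 - z) * (1 - z) ^ k) =
            (1 - z) * (/ RtoC (INR (S k)) * (1 - z) ^ k)). ring. }
  split; [|split].
  - apply (power_branch_hol (bdf_symbol p) omega alpha); [|exact H].
    apply (hol_sub (fun _ => True)); [trivial|].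
    apply (hol_ext _ (fun z => (1 - z) * P z)); [intros; now apply near_all | now symmetry |].
    apply hol_mult; [apply hol_one_sub | exact HP].
  - intros z Hz. apply contw_of_continuous; [apply H | exact Hz].
  - destruct (hol_bounded_at_1 P HP) as [M [HM HN]].
    exists (Rpower M alpha). split; [apply exp_pos|].
    eapply near_imp; [|exact HN]. intros z Hz Dz.
    destruct (power_branch_Cmod _ _ _ z H Dz) as [N0 ->].
    apply Cmod_gt_0 in N0. rewrite E, Cmod_mult in *.
    pose proof (unit_disk_sub_pos z Dz) as Hx.
    rewrite Rpower_mult_distr by trivial. apply Rpower_le_base; [|exact Ha].
    split; [exact N0|]. rewrite Rmult_comm. apply Rmult_le_compat_r; lra.
Qed.

(** Here the power of [1 - z] is already a factor. The product formula is known on the closed disk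
    only, so it is transferred by extensionality on that set. *)
Lemma newton_gregory_regularity (p : nat) (alpha : R) (omega : C -> C) :
  is_newton_gregory p alpha omega ->
  hol disk omega /\ (forall z, closed_disk z -> contw closed_disk omega z) /\
  order_alpha_at_1 alpha omega.
Proof.
  intros [g [H E]].
  set (P := fun z => sum_n_m (fun k => RtoC (ng_coef alpha (k - 1)) * (1 - z) ^ (k - 1)) 1 p).
  assert (HP : hol (fun _ => True) P).
  { apply (hol_sum (fun k z => RtoC (ng_coef alpha (k - 1)) * (1 - z) ^ (k - 1))). intros k.
    apply hol_mult; [apply hol_const | apply hol_pow, hol_one_sub]. }
  change (forall z, closed_disk z -> omega z = g z * P z) in E.
  split; [|split].
  - apply (hol_ext _ (fun z => g z * P z)); [exact disk_open | |].
    + intros z Hz. symmetry. now apply E, disk_sub_closed.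
    + apply hol_mult; [|now apply (hol_sub (fun _ => True))].
      apply (power_branch_hol (fun z => 1 - z) g alpha); [apply hol_one_sub | exact H].
  - intros z Hz. apply (contw_ext _ (fun z => g z * P z)); [|exact Hz|].
    + apply near_all. intros w Dw. symmetry. now apply E.
    + apply contw_mult; [now apply contw_of_continuous; [apply H|]|].
      apply cont_contw. now apply (hol_cont (fun _ => True)).
  - destruct (hol_bounded_at_1 P HP) as [M [HM HN]].
    exists M. split; [exact HM|].
    eapply near_imp; [|exact HN]. intros z Hz Dz.
    rewrite E by now apply disk_sub_closed. rewrite Cmod_mult, Rmult_comm.
    destruct (power_branch_Cmod _ _ _ z H Dz) as [_ ->].
    apply Rmult_le_compat_r; [left; apply exp_pos | exact Hz].
Qed.

(** * The recursion *)

Lemma conv_sum_n (a u : nat -> C) (n : nat) :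
  conv a u n = sum_n (fun j => a (n - j)%nat * u j) n.
Proof.
  revert u. induction n as [|n IH]; intros u.
  - now rewrite sum_O.
  - unfold sum_n. rewrite sum_Sn_m by lia.
    rewrite <- (sum_n_m_S (fun j => a (S n - j)%nat * u j) 0 n). simpl conv. rewrite IH.
    reflexivity.
Qed.

Lemma conv_plus_scal_l (a d u : nat -> C) (c : C) (n : nat) :
  conv (fun k => a k + c * d k) u n = conv a u n + c * conv d u n.
Proof. revert u. induction n as [|n IH]; intros u; simpl; [ring | rewrite IH; ring]. Qed.

(** The convolution of [a] with 1 gives the partial sums of [a], that is, the coefficients of its
    generating function divided by [1 - z]. *)
Lemma conv_minus_const_r (a u : nat -> C) (c : C) (n : nat) :
  conv a (fun k => u k - c) n = conv a u n - c * conv a (fun _ => 1) n.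
Proof.
  revert u. induction n as [|n IH]; intros u; simpl; [ring|].
  rewrite (IH (fun k => u (S k))). ring.
Qed.

Lemma conv_quadratic (d u : nat -> C) (n : nat) :
  (forall k, d (S (S (S k))) = 0) ->
  conv d u (S (S n)) = d 0%nat * u (S (S n)) + d 1%nat * u (S n) + d 2%nat * u n.
Proof.
  intros H. revert u. induction n as [|n IH]; intros u; [simpl; ring|].
  change (d (S (S (S n))) * u 0%nat + conv d (fun k => u (S k)) (S (S n)) =
    d 0%nat * u (S (S (S n))) + d 1%nat * u (S (S n)) + d 2%nat * u (S n)).
  rewrite H, IH. ring.
Qed.

(** * Behaviour at 1 and decay for the quotient *)

(** Half of [alpha] is given away: [x^(alpha-1) = x^(alpha/2) * x^(-(1-alpha/2))], and the first
    factor is as small as desired near 1. *)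
Lemma vanishing_at_1 (alpha M : R) (h : C -> C) (eta : R) :
  (0 < alpha)%R -> (0 < M)%R -> (0 < eta)%R ->
  near 1 (fun z => disk z -> (Cmod (h z) <= M * Rpower (Cmod (1 - z)) (alpha - 1))%R) ->
  near 1 (fun z => disk z -> (Cmod (h z) <= eta * weight (1 - alpha / 2) z)%R).
Proof.
  intros Ha HM He H.
  (* Exactly the radius at which [M * x^(alpha/2)] reaches [eta]. *)
  assert (Hr : near 1 (fun z => (Cmod (1 - z) < Rpower (eta / M) (2 / alpha))%R)).
  { exists (Rpower (eta / M) (2 / alpha)). split; [apply exp_pos|].
    intros w Hw. now rewrite Cmod_sub_sym. }
  eapply near_imp; [|exact (near_and _ _ _ H Hr)]. intros z [H1 H2] Dz. specialize (H1 Dz).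
  pose proof (unit_disk_sub_pos z Dz) as Hx. unfold weight. set (x := Cmod (1 - z)) in *.
  replace (alpha - 1)%R with (alpha / 2 + - (1 - alpha / 2))%R in H1 by field.
  rewrite Rpower_plus, <- Rmult_assoc in H1.
  eapply Rle_trans; [exact H1|]. apply Rmult_le_compat_r; [left; apply exp_pos|].
  assert (Q : (Rpower x (alpha / 2) <= Rpower (Rpower (eta / M) (2 / alpha)) (alpha / 2))%R).
  { apply Rpower_le_base; lra. }
  rewrite Rpower_mult in Q. replace (2 / alpha * (alpha / 2))%R with 1%R in Q by (field; lra).
  rewrite Rpower_1 in Q by now apply Rdiv_lt_0_compat.
  apply Rle_trans with (M * (eta / M))%R; [apply Rmult_le_compat_l; lra | right; field; lra].
Qed.

(** Imaginary parts follow from the real case for [- Ci * h], which satisfies the same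
    hypotheses. *)
Lemma coef_to_0 (h : C -> C) (u : nat -> C) (g : R) :
  (0 <= g < 1)%R -> hol punctured_disk h -> (forall n, jet n h u) ->
  (forall eta, (0 < eta)%R -> exists d, (0 < d)%R /\
     forall z z', (Cmod z < 1)%R -> (Cmod z' < 1)%R -> (Cmod (z - z') < d)%R ->
       (Cmod (h z - h z') <= eta * (weight g z + weight g z'))%R) ->
  filterlim u eventually (locally (RtoC 0)).
Proof.
  intros Hg Hh Hj Hm P [e HP]. assert (He2 : (0 < e / 2)%R) by (pose proof (cond_pos e); lra).
  destruct (coef_Re_to_0 h u g Hg Hh Hj Hm _ He2) as [N1 H1].
  destruct (coef_Re_to_0 (fun z => - Ci * h z) (fun n => - Ci * u n) g Hg) with (e := (e / 2)%R)
    as [N2 H2]; trivial.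
  - apply hol_mult; [apply hol_const | exact Hh].
  - intros n. now apply jet_scal.
  - intros eta Heta. destruct (Hm eta Heta) as [d [Hd Hz]]. exists d. split; [exact Hd|].
    intros z z' A B D. replace (- Ci * h z - - Ci * h z') with (- Ci * (h z - h z')) by ring.
    rewrite Cmod_mult, Cmod_opp, Cmod_Ci, Rmult_1_l. auto.
  - exists (Nat.max N1 N2). intros n Hn. apply HP.
    specialize (H1 n ltac:(lia)). specialize (H2 n ltac:(lia)).
    replace (Re (- Ci * u n)) with (Im (u n)) in H2 by (unfold Re, Im; simpl; ring).
    split.
    + change (Rabs (Re (u n) - 0) < e)%R. rewrite Rminus_0_r. lra.
    + change (Rabs (Im (u n) - 0) < e)%R. rewrite Rminus_0_r. lra.
Qed.

(** At 1 the denominator [G] stays away from 0, [omega z / (1 - z)] is [O(|1-z|^(alpha-1))], and the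
    polynomial part is absorbed because that power is at least 1 for [|1-z| < 1]. *)
Lemma quotient_to_0 (alpha : R) (omega F G : C -> C) (r0 r1 v : C) (u : nat -> C) :
  (0 < alpha <= 1)%R ->
  hol disk omega -> (forall z, closed_disk z -> contw closed_disk omega z) ->
  order_alpha_at_1 alpha omega ->
  (forall z, F z = (r0 + z * r1) + v * (omega z * / (1 - z))) ->
  hol disk G -> (forall z, closed_disk z -> contw closed_disk G z) ->
  (forall z, closed_disk z -> G z <> 0) ->
  (forall n, jet n (fun z => F z * / G z) u) ->
  filterlim u eventually (locally (RtoC 0)).
Proof.
  intros Ha Ho Co [K [HK Bo]] EF HG CG NG Hj.
  assert (N1 : forall z : C, z <> 1 -> 1 - z <> 0)
    by (intros z Hz; now apply Csub_neq_0, not_eq_sym).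
  assert (HF : hol disk F).
  { apply (hol_ext _ (fun z => (r0 + z * r1) + v * (omega z * / (1 - z))));
      [exact disk_open | now symmetry |].
    apply hol_plus.
    - apply hol_plus; [apply hol_const|]. apply hol_mult; [apply hol_id | apply hol_const].
    - apply hol_mult; [apply hol_const|]. apply hol_mult; [exact Ho|].
      apply hol_inv; [apply hol_one_sub|]. intros z Hz. apply N1. intros ->.
      unfold disk in Hz. rewrite Cmod_1 in Hz. lra. }
  apply (coef_to_0 (fun z => F z * / G z) u (1 - alpha / 2)); [lra | | exact Hj |].
  - apply (hol_sub disk); [now intros z [_ Hz]|].
    apply hol_mult; [exact HF|]. apply hol_inv; [exact HG|].
    intros z Hz. now apply NG, disk_sub_closed.
  - intros eta Heta.
    apply (weighted_modulus (fun z => F z * / G z)); [lra | exact Heta | |].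
    + intros z0 Hz0 Nz0. apply (contw_sub closed_disk disk); [exact disk_sub_closed|].
      apply contw_mult; [|apply contw_inv; auto].
      apply (contw_ext _ (fun z => (r0 + z * r1) + v * (omega z * / (1 - z))));
        [now apply near_all | exact Hz0 |].
      apply contw_plus.
      * apply contw_plus; [apply contw_const|].
        apply contw_mult; [apply contw_id | apply contw_const].
      * apply contw_mult; [apply contw_const|]. apply contw_mult; [now apply Co|].
        apply contw_inv; [|now apply N1].
        apply contw_minus; [apply contw_const | apply contw_id].
    + assert (D1 : closed_disk 1) by (unfold closed_disk; rewrite Cmod_1; lra).
      set (A := (Cmod r0 + Cmod r1 + Cmod v * K)%R).
      assert (HA : (0 <= A)%R).
      { pose proof (Cmod_ge_0 r0). pose proof (Cmod_ge_0 r1).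
        pose proof (Rmult_le_pos _ _ (Cmod_ge_0 v) (Rlt_le _ _ HK)). unfold A. lra. }
      pose proof (NG 1 D1) as G1. apply Cmod_gt_0 in G1 as G1'.
      (* Adding 1 keeps the constant positive even when [A = 0]. *)
      apply (vanishing_at_1 alpha (A * / (Cmod (G 1) / 2) + 1)); [lra | | exact Heta |].
      { assert (0 <= A * / (Cmod (G 1) / 2))%R; [|lra].
        apply Rmult_le_pos; [exact HA|]. left. apply Rinv_0_lt_compat. lra. }
      eapply near_imp;
        [|exact (near_and _ _ _ (near_and _ _ _ Bo (contw_lower_bound _ _ _ (CG 1 D1) G1))
                   (ex_intro _ 1%R (conj Rlt_0_1 (fun w Hw => Hw))))].
      intros z [[Bz Gz] Xz] Dz. rewrite Cmod_sub_sym in Xz.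
      specialize (Bz Dz). specialize (Gz (disk_sub_closed z Dz)).
      pose proof (NG z (disk_sub_closed z Dz)) as Nz.
      rewrite Cmod_mult, Cmod_inv by exact Nz.
      pose proof (unit_disk_sub_pos z Dz) as Hx.
      assert (N1z : 1 - z <> 0) by (now apply Cmod_gt_0).
      set (x := Cmod (1 - z)) in *. set (W := Rpower x (alpha - 1)).
      assert (HW : (1 <= W)%R).
      { replace 1%R with (Rpower 1 (- (1 - alpha))).
        2:{ unfold Rpower. rewrite ln_1, Rmult_0_r. apply exp_0. }
        unfold W. replace (alpha - 1)%R with (- (1 - alpha))%R by ring.
        apply Rpower_le_opp; lra. }
      assert (HxW : (Rpower x alpha * / x = W)%R).
      { unfold W, Rminus. rewrite Rpower_plus, Rpower_Ropp, Rpower_1 by trivial. reflexivity. }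
      assert (FW : (Cmod (F z) <= A * W)%R).
      { rewrite EF. eapply Rle_trans; [apply Cmod_triangle|].
        rewrite !Cmod_mult, Cmod_inv by exact N1z. fold x.
        pose proof (Cmod_triangle r0 (z * r1)) as T. rewrite Cmod_mult in T.
        assert (T1 : (Cmod z * Cmod r1 <= Cmod r1)%R).
        { rewrite <- (Rmult_1_l (Cmod r1)) at 2. apply Rmult_le_compat_r; [apply Cmod_ge_0|].
          unfold disk in Dz. lra. }
        assert (T2 : ((Cmod r0 + Cmod r1) * 1 <= (Cmod r0 + Cmod r1) * W)%R).
        { apply Rmult_le_compat_l; [|exact HW].
          pose proof (Cmod_ge_0 r0). pose proof (Cmod_ge_0 r1). lra. }
        assert (T3 : (Cmod v * (Cmod (omega z) * / x) <= Cmod v * (K * W))%R).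
        { apply Rmult_le_compat_l; [apply Cmod_ge_0|]. rewrite <- HxW, <- Rmult_assoc.
          apply Rmult_le_compat_r; [left; now apply Rinv_0_lt_compat | exact Bz]. }
        unfold A. lra. }
      apply Rle_trans with (A * W * / (Cmod (G 1) / 2))%R.
      * apply Rmult_le_compat; trivial; try apply Cmod_ge_0.
        -- left. apply Rinv_0_lt_compat. lra.
        -- apply Rinv_le_contravar; lra.
      * rewrite Rmult_plus_distr_r. lra.
Qed.

Theorem theorem2p1 :
  forall (alpha : R) (p q : nat) (lambda rho kappa : C)
         (omega : C -> C) (w : nat -> C) (tau : R),
    (0 < alpha <= 1)%R ->
    (1 <= p <= 6)%nat ->
    q = 1%nat \/ q = 2%nat ->
    (Re lambda < 0)%R ->
    is_fbdf p alpha omega \/ is_newton_gregory p alpha omega ->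
    taylor_coefs omega w ->
    (0 < tau)%R ->
    step_in_S alpha q lambda rho kappa omega tau ->
    stable alpha q lambda rho kappa w tau.
Proof.
  intros alpha p q lambda rho kappa omega w tau Ha _ Hq _ Hom Hw _ HS U HU.
  assert (Reg : hol disk omega /\ (forall z, closed_disk z -> contw closed_disk omega z) /\
                order_alpha_at_1 alpha omega).
  { destruct Hom as [H|H]; [apply (fbdf_regularity p) | apply (newton_gregory_regularity p)];
      trivial; lra. }
  destruct Reg as [Ho [Co Bo]].
  set (x := RtoC (Rpower tau alpha)).
  assert (Hx : x <> 0).
  { apply Cmod_gt_0. unfold x. rewrite Cmod_R, Rabs_pos_eq; [apply exp_pos | left; apply exp_pos]. }
  set (a := lambda + rho). set (b := rho + kappa).
  (* The coefficients of the polynomial [a - b (1 - z)^q]. *)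
  set (d := fun k : nat => match k return C with
    | 0%nat => a - b
    | 1%nat => if Nat.eqb q 1 then b else 2 * b
    | 2%nat => if Nat.eqb q 1 then RtoC 0 else - b
    | _ => RtoC 0 end).
  (* Horner form down to [z * 0], so that its expansion is three uses of [jet_cons] on [jet_0]. *)
  set (G := fun z => omega z + - x * (d 0%nat + z * (d 1%nat + z * (d 2%nat + z * 0)))).
  set (gc := fun k => w k + - x * d k).
  assert (EG : forall z, G z = omega z - x * (a - b * (1 - z) ^ q)).
  { intros z. unfold G, d. destruct Hq as [-> | ->]; simpl; ring. }
  assert (Jw : forall n, jet n omega w) by (intros n; apply pseries_jet; auto).
  assert (Jg : forall n, jet n G gc).
  { intros n. unfold G, gc. apply jet_plus; [apply Jw|]. apply jet_scal.
    eapply jet_ext; [apply near_all; reflexivity | |].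
    2:{ apply jet_cons, jet_cons, jet_cons, jet_0. }
    intros [|[|[|k]]] _; reflexivity. }
  (* The formal coefficients of [G] times the series of [U], minus those of
     [U_0 omega(z) / (1 - z)]. The recursion makes them vanish from index 2 on, an index that is at
     least [q] in both cases. *)
  set (r := fun k => conv gc U k - U 0%nat * conv w (fun _ => 1) k).
  assert (Hr : forall k, r (S (S k)) = 0).
  { intros k. unfold r. set (n := S (S k)).
    unfold gc. rewrite conv_plus_scal_l.
    transitivity (conv w (fun k => U k - U 0%nat) n - x * conv d U n);
      [rewrite conv_minus_const_r; ring|].
    rewrite conv_sum_n.
    assert (Eq : sum_n (fun j => w (n - j)%nat * (U j - U 0%nat)) n =
                 x * (a * U n - b * perturbation q U n)).
    { unfold a, b. rewrite <- HU by (unfold n; lia). fold x.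
      rewrite Cmult_assoc, Cinv_r by exact Hx. symmetry. apply Cmult_1_l. }
    rewrite Eq. unfold n. rewrite conv_quadratic by reflexivity.
    unfold d, perturbation. replace (S (S k) - 1)%nat with (S k) by lia.
    replace (S (S k) - 2)%nat with k by lia.
    destruct Hq as [-> | ->]; simpl; ring. }
  set (F := fun z => (r 0%nat + z * r 1%nat) + U 0%nat * (omega z * / (1 - z))).
  assert (NG : forall z, closed_disk z -> G z <> 0).
  { intros z Hz. rewrite EG. now apply HS. }
  assert (CG : forall z, closed_disk z -> contw closed_disk G z).
  { intros z Hz. unfold G. apply contw_plus; [now apply Co|].
    repeat first [apply contw_const | apply contw_id | apply contw_mult | apply contw_plus]. }
  assert (HG : hol disk G).
  { unfold G. apply hol_plus; [exact Ho|].
    repeat first [apply hol_const | apply hol_id | apply hol_mult | apply hol_plus]. }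
  assert (D0 : disk 0) by (unfold disk; rewrite Cmod_0; lra).
  apply (quotient_to_0 alpha omega F G (r 0%nat) (r 1%nat) (U 0%nat)); trivial.
  (* It remains to expand [G * (F / G) = F]: by the definition of [r], its coefficients are those of
     [conv gc U]. *)
  intros n. apply (jet_div n G _ gc).
  - exact (hol_cont _ _ 0 HG D0).
  - apply NG, disk_sub_closed, D0.
  - exact Jg.
  - apply (jet_ext n F _ (fun k => match k with
      | O => r 0%nat | S O => r 1%nat | _ => 0 end
      + U 0%nat * conv w (fun _ => 1) k)).
    + eapply near_imp; [|exact (disk_open 0 D0)]. intros z Hz _.
      field. now apply NG, disk_sub_closed.
    + intros [|[|k]] _.
      * unfold r. ring.
      * unfold r. ring.
      * rewrite <- (Hr k). unfold r. ring.
    + unfold F. apply jet_plus.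
      * apply (jet_ext n (fun z => r 0%nat + z * (r 1%nat + z * 0)) _
          (fun k => match k with
            | O => r 0%nat
            | S k => match k with O => r 1%nat | S _ => 0 end end)).
        -- apply near_all. intros z _. ring.
        -- intros [|[|k]] _; reflexivity.
        -- apply jet_cons, (jet_cons n (fun _ => 0) (fun _ => 0)), jet_0.
      * apply jet_scal, jet_mult; [apply Jw | apply jet_geometric].
Qed.
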